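(* Let $\mathcal V=\{V;\nu_1,\dots,\nu_n\}$ be a signed vector arrangement over $\Bbbk$ and let $l\in[n]$. There is a long exact sequence of homology groups, depending on the sign of $l$. If $l\in[n]_+$, then $$\cdots\to H_{Kh}^{i-1/2}(\mathcal V^{\nu_l})\{1/2\}\to H_{Kh}^i(\mathcal V)\to H_{Kh}^{i-1/2}(\mathcal V-\nu_l)\{1/2\}\xrightarrow{\ \gamma_+\ }H_{Kh}^{i+1/2}(\mathcal V^{\nu_l})\{1/2\}\to\cdots$$ where $$\gamma_+(x\otimes y)=\begin{cases}x\otimes y&\text{if }\nu_l\notin V_{\widetilde S}\\ x\otimes(\nu_l^\vee\wedge y)&\text{if }\nu_l\in V_{\widetilde S}.\end{cases}$$ If $l\in[n]_-$, then $$\cdots\to H_{Kh}^{i-1/2}(\mathcal V-\nu_l)\{1/2\}\to H_{Kh}^i(\mathcal V)\to H_{Kh}^{i-1/2}(\mathcal V^{\nu_l})\{1/2\}\xrightarrow{\ \gamma_-\ }H_{Kh}^{i+1/2}(\mathcal V-\nu_l)\{1/2\}\to\cdots$$ where $$\gamma_-(x\otimes y)=\begin{cases}(\nu_l\wedge x)\otimes y&\text{if }\nu_l\notin V_{\widetilde S-l}\\ x\otimes y&\text{if }\nu_l\in V_{\widetilde S-l}.\end{cases}$$ Here $x\otimes y$ lies in the component indexed by $S$ with $l\notin S$, and $\{\cdot\}$ denotes a shift of the $q$-grading.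
   Context: Let $\Bbbk$ be a field of characteristic zero. A signed vector arrangement $\mathcal V=\{V;\nu_1,\dots,\nu_n\}$ is a finite-dimensional $\Bbbk$-vector space $V$ with an inner product, a list of vectors $\nu_i\in V$ (zero allowed) and a sign for each $\nu_i$, giving a partition $[n]=\{1,\dots,n\}=[n]_+\sqcup[n]_-$. For $S\subseteq[n]$: $H_S=\bigcap_{s\in S}\nu_s^\perp$ ($H_\emptyset=V$), $V_S=\mathrm{span}\{\nu_s\}_{s\in S}$, $W=\{w\in\Bbbk^n:\sum w_i\nu_i=0\}$ with inner product induced from the standard one on $\Bbbk^n$, $W_S=\{w\in W:w_r=0\text{ for }r\notin S\}$, $\widetilde S=(S\cap[n]_+)\cup([n]_-\setminus S)$. The vector $\nu_r^\vee\in W$ is the orthogonal projection of the $r$-th standard basis vector of $\Bbbk^n$ to $W$. Inner products are understood to restrict non-degenerately to all subspaces onto which orthogonal projections are taken. $\mathcal V-\nu_l$ is $\mathcal V$ with $\nu_l$ removed; $\mathcal V^{\nu_l}$ is the arrangement in $\nu_l^\perp$ of the orthogonal projections of the $\nu_j$, $j\ne l$. Signs of remaining vectors are kept. Complex $\mathcal T(\mathcal V)=\bigoplus_{S\subseteq[n]}T_S$, $T_S=\bigwedge^\bullet H_{\widetilde S}\otimes\bigwedge^\bullet W_{\widetilde S}$, with (integer or half-integer) bigrading $\deg(\bigwedge^iH_{\widetilde S}\otimes\bigwedge^jW_{\widetilde S})=(|S|-n/2,\ |S|+\dim H_{\widetilde S}+\dim W_{\widetilde S}-2(i+j)-n/2)$;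 the first degree is homological, the second is the $q$-degree. For $r\notin S$, $\delta_{S,r}:T_S\to T_{S\cup r}$ is: (1) if $r\in[n]_+$, $\nu_r\notin V_{\widetilde S}$: (map induced by orthogonal projection $H_{\widetilde S}\to H_{\widetilde S\cup r}$) $\otimes$ (inclusion $W_{\widetilde S}\subseteq W_{\widetilde S\cup r}$); (2) if $r\in[n]_+$, $\nu_r\in V_{\widetilde S}$: (projection) $\otimes$ (inclusion into $\bigwedge^\bullet W_{\widetilde S\cup r}$ followed by left wedge with the projection of $\nu_r^\vee$ to $W_{\widetilde S\cup r}$); (3) if $r\in[n]_-$, $\nu_r\in V_{\widetilde S-r}$: (inclusion $H_{\widetilde S}\subseteq H_{\widetilde S-r}$) $\otimes$ (orthogonal projection $W_{\widetilde S}\to W_{\widetilde S-r}$); (4) if $r\in[n]_-$, $\nu_r\notin V_{\widetilde S-r}$: (inclusion into $\bigwedge^\bullet H_{\widetilde S-r}$ followed by left wedge with the projection of $\nu_r$ to $H_{\widetilde S-r}$) $\otimes$ (projection). The differential is $\delta=\bigoplus_{S,\,r\notin S}\epsilon_{S,r}\delta_{S,r}$ for a choice of nonzero scalars $\epsilon_{S,r}\in\Bbbk^\times$ making every square of the cube anticommute (such a choice exists, and the homology does not depend on it). $H_{Kh}^j(\mathcal V)$ is the homology in homological degree $j$, graded by $q$-degree. The maps $\gamma_\pm$ are the connecting maps of the snake lemma. In their formulas the scalar assignments of the three complexes are understood to be suitably matched, $x\otimes y$ is regarded as an element of the target summand via the same inclusions and orthogonal projections as in $\delta_{S,l}$, $\widetilde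 S$ is formed in $[n]$ for $S\subseteq[n]\setminus\{l\}$, and the summand of $\mathcal T(\mathcal V^{\nu_l})$ indexed by $S\subseteq[n]\setminus\{l\}$ is identified, as the paper does, with $\bigwedge^\bullet H_{U\cup l}\otimes\bigwedge^\bullet W_{U\cup l}$, where $U=\widetilde S\setminus\{l\}$.
   Formalization: The third term (and source of γ±) is H^{i+1/2}{-1/2} of the quotient arrangement, not the printed H^{i-1/2}{1/2}, which is not exact; if ν_l=0, the complex of V^{ν_l} is replaced by the summands ΛH_{U∪l}⊗ΛW_{U∪l} of T(V), as the stated identification fails there. *)

(* Defs.v *)
From HB Require Import structures.
From mathcomp Require Import all_boot all_order all_algebra.

Set Implicit Arguments.
Unset Strict Implicit.
Unset Printing Implicit Defensive.

Import GRing.Theory.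
Local Open Scope ring_scope.

(* ext V is the exterior algebra of V, with basis the e_B = e_b1 /\ e_b2 /\ ...  *)
(* for B = {b1 < b2 < ...}, where the e_i form the basis vbasis {:V} of V.      *)
Definition ext (K : fieldType) (V : vectType K) : vectType K :=
  {ffun {set 'I_(\dim {:V})} -> K^o}.

(* ext V (x) ext W, with basis the e_B (x) e_C.                                 *)
Definition tens (K : fieldType) (V W : vectType K) : vectType K :=
  {ffun {set 'I_(\dim {:V})} * {set 'I_(\dim {:W})} -> K^o}.

Section Exterior.
Variables (K : fieldType) (V : vectType K).

Definition ebase (B : {set 'I_(\dim {:V})}) : ext V := [ffun C => (C == B)%:R].

Definition lwedge_fun (v : V) (x : ext V) : ext V :=
  [ffun B : {set 'I_(\dim {:V})} => \sum_(i in B)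
     coord (vbasis {:V}) i v * (-1) ^+ #|[set a in B | (a < i)%N]| * x (B :\ i)].

Definition lwedge (v : V) : 'End(ext V) := linfun (lwedge_fun v).

Fact lwedge_fun_linear v : linear (lwedge_fun v).
Proof.
move=> a x y; apply/ffunP=> B; rewrite !ffunE.
rewrite [X in _ = X + _]mulr_sumr -big_split /=; apply: eq_bigr => i _.
by rewrite !ffunE mulrDr; congr (_ + _); exact: mulrCA.
Qed.

HB.instance Definition _ v :=
  GRing.isLinear.Build K (ext V) (ext V) _ (lwedge_fun v) (lwedge_fun_linear v).

Lemma lwedgeE v x : lwedge v x = lwedge_fun v x.
Proof. by rewrite lfunE. Qed.

Definition wedge (s : seq V) : ext V := foldr (fun v => lwedge v) (ebase set0) s.

Definition extpow (H : {vspace V}) (i : nat) : {vspace ext V} :=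
  <<[seq wedge [seq tnth (vbasis H) j | j <- t] | t : i.-tuple 'I_(\dim H)]>>%VS.

End Exterior.

Section Functoriality.
Variable K : fieldType.

Section Map.
Variables (V V' : vectType K) (f : 'Hom(V, V')).

Definition extmap_fun (x : ext V) : ext V' :=
  \sum_B x B *: wedge [seq f (tnth (vbasis {:V}) i) | i <- enum B].

Fact extmap_fun_linear : linear extmap_fun.
Proof.
move=> a x y; rewrite /extmap_fun scaler_sumr -big_split /=.
by apply: eq_bigr => B _; rewrite !ffunE scalerDl scalerA.
Qed.

HB.instance Definition _ :=
  GRing.isLinear.Build K (ext V) (ext V') _ extmap_fun extmap_fun_linear.

Definition extmap : 'Hom(ext V, ext V') := linfun extmap_fun.

Lemma extmapE x : extmap x = extmap_fun x.
Proof. by rewrite lfunE. Qed.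

End Map.

Definition tensor (V W : vectType K) (x : ext V) (y : ext W) : tens V W :=
  [ffun p => x p.1 * y p.2].

Definition tensv (V W : vectType K) (X : {vspace ext V}) (Y : {vspace ext W}) :
    {vspace tens V W} :=
  <<[seq tensor x y | x <- vbasis X, y <- vbasis Y]>>%VS.

Section TensorMap.
Variables (V W V' W' : vectType K).
Variables (f : 'Hom(ext V, ext V')) (g : 'Hom(ext W, ext W')).

Definition tmap_fun (t : tens V W) : tens V' W' :=
  \sum_p t p *: tensor (f (ebase p.1)) (g (ebase p.2)).

Fact tmap_fun_linear : linear tmap_fun.
Proof.
move=> a x y; rewrite /tmap_fun scaler_sumr -big_split /=.
by apply: eq_bigr => B _; rewrite !ffunE scalerDl scalerA.
Qed.

HB.instance Definition _ :=
  GRing.isLinear.Build K (tens V W) (tens V' W') _ tmap_fun tmap_fun_linear.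

Definition tmap : 'Hom(tens V W, tens V' W') := linfun tmap_fun.

Lemma tmapE t : tmap t = tmap_fun t.
Proof. by rewrite lfunE. Qed.

End TensorMap.
End Functoriality.

(* A cube of graded vector spaces: all vertices are subspaces of one ambient    *)
(* space, and vertex S has pieces of exterior degree k for 0 <= k <= topdeg S.  *)
Record cube (K : fieldType) (n : nat) := Cube {
  amb : vectType K;
  topdeg : {set 'I_n} -> nat;
  piece : {set 'I_n} -> nat -> {vspace amb};
  edge : {set 'I_n} -> 'I_n -> 'End(amb)
}.

Definition scalars (K : fieldType) (n : nat) := {set 'I_n} -> 'I_n -> K.

Section Complex.
Variables (K : fieldType) (n : nat) (Q : cube K n).

Definition vertex (S : {set 'I_n}) : {vspace amb Q} :=
  (\sum_(k < (topdeg Q S).+1) piece Q S k)%VS.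

Definition anticommuting (eps : scalars K n) : Prop :=
  (forall (S : {set 'I_n}) r, r \notin S -> eps S r != 0) /\
  (forall (S : {set 'I_n}) r s, r \notin S -> s \notin S -> r != s ->
     {in vertex S, forall t,
        eps (r |: S) s *: edge Q (r |: S) s (eps S r *: edge Q S r t) +
        eps (s |: S) r *: edge Q (s |: S) r (eps S s *: edge Q S s t) = 0}).

Definition cochain : vectType K := {ffun {set 'I_n} -> amb Q}.

Definition inj_fun (S : {set 'I_n}) (t : amb Q) : cochain :=
  [ffun S' => if S' == S then t else 0].

Fact inj_fun_linear S : linear (inj_fun S).
Proof.
move=> a x y; apply/ffunP=> S'; rewrite !ffunE.
by case: eqP => // _; rewrite scaler0 addr0.
Qed.

HB.instance Definition _ S :=
  GRing.isLinear.Build K (amb Q) cochain _ (inj_fun S) (inj_fun_linear S).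

Definition inj S : 'Hom(amb Q, cochain) := linfun (inj_fun S).

Definition total : {vspace cochain} := (\sum_S inj S @: vertex S)%VS.

Definition hdeg (S : {set 'I_n}) : rat := #|S|%:R - n%:R / 2.

Definition qdeg (S : {set 'I_n}) (k : nat) : rat :=
  #|S|%:R + (topdeg Q S)%:R - 2 * k%:R - n%:R / 2.

Definition bipiece (j q : rat) : {vspace cochain} :=
  (\sum_(S | hdeg S == j) \sum_(k < (topdeg Q S).+1 | qdeg S k == q)
     inj S @: piece Q S k)%VS.

Section Homology.
Variable eps : scalars K n.

Definition diff_fun (t : cochain) : cochain :=
  [ffun S : {set 'I_n} =>
     \sum_(r in S) eps (S :\ r) r *: edge Q (S :\ r) r (t (S :\ r))].

Fact diff_fun_linear : linear diff_fun.
Proof.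
move=> a x y; apply/ffunP=> S; rewrite !ffunE scaler_sumr -big_split /=.
apply: eq_bigr => r _; rewrite !ffunE linearD linearZ /= scalerDr !scalerA.
by rewrite mulrC.
Qed.

HB.instance Definition _ :=
  GRing.isLinear.Build K cochain cochain _ diff_fun diff_fun_linear.

Definition diff : 'End(cochain) := linfun diff_fun.

Definition cycles : {vspace cochain} := (total :&: lker diff)%VS.
Definition boundaries : {vspace cochain} := (diff @: total)%VS.

(* The quotient cycles / boundaries, realized on a complement of boundaries in  *)
(* cycles; only the values of hclass on cycles are meaningful.                  *)
Definition homology : vectType K := subvs_of (cycles :\: boundaries)%VS.

Definition hclass_fun (t : cochain) : homology :=
  vsproj (cycles :\: boundaries) (addv_pi1 cycles boundaries t).

Fact hclass_fun_linear : linear hclass_fun.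
Proof. by move=> a x y; rewrite /hclass_fun !linearP. Qed.

HB.instance Definition _ :=
  GRing.isLinear.Build K cochain homology _ hclass_fun hclass_fun_linear.

Definition hclass : 'Hom(cochain, homology) := linfun hclass_fun.

Lemma hclass_eq0 z : (boundaries <= cycles)%VS -> z \in cycles ->
  (hclass z == 0) = (z \in boundaries).
Proof.
move=> sBZ Zz; rewrite lfunE /= /hclass_fun.
have dZB : ((cycles :\: boundaries) :&: boundaries = 0)%VS.
  exact: capv_diff.
have zZB : z \in (cycles :\: boundaries + boundaries)%VS.
  by rewrite addv_diff (addv_idPl sBZ).
have addz := daddv_pi_add dZB zZB.
have -> : (vsproj (cycles :\: boundaries) (addv_pi1 cycles boundaries z) == 0) =
          (addv_pi1 cycles boundaries z == 0).
  by rewrite -(inj_eq val_inj) /= vsprojK // memv_pi.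
apply/eqP/idP => [z0 | Bz].
  by move: addz; rewrite -/(addv_pi1 _ _) z0 add0r => <-; exact: memv_pi.
have Bpi : daddv_pi boundaries (cycles :\: boundaries) z = z.
  by apply: daddv_pi_id; rewrite // capvC.
by move: addz; rewrite Bpi => /(canRL (addrK z)); rewrite subrr.
Qed.

Lemma hclass_surj h : exists2 z, z \in cycles & hclass z = h.
Proof.
have hZ : vsval h \in cycles.
  by apply: subvP (subvsP h); exact: diffvSl.
exists (vsval h) => //; rewrite lfunE /= /hclass_fun /addv_pi1.
by rewrite daddv_pi_id ?vsvalK ?subvsP ?capv_diff.
Qed.

Definition HKh (j q : rat) : {vspace homology} :=
  (hclass @: (bipiece j q :&: lker diff))%VS.

End Homology.
End Complex.

(* The cube seen on the facet of subsets of 'I_n.+1 that contain l (if b) or    *)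
(* avoid l (if ~~ b); the remaining directions are renumbered by lift l.        *)
Definition facet_set (n : nat) (l : 'I_n.+1) (b : bool) (S : {set 'I_n}) :
    {set 'I_n.+1} :=
  if b then l |: (lift l @: S) else lift l @: S.

Definition facet (K : fieldType) (n : nat) (Q : cube K n.+1) (l : 'I_n.+1)
    (b : bool) : cube K n :=
  @Cube K n (amb Q) (fun S => topdeg Q (facet_set l b S))
    (fun S => piece Q (facet_set l b S))
    (fun S r => edge Q (facet_set l b S) (lift l r)).

Definition facet_ident (K : fieldType) (n : nat) (Q : cube K n.+1) (l : 'I_n.+1)
    (b : bool) : 'Hom(amb (facet Q l b), amb Q) := (\1%VF : 'End(amb Q)).

Section StandardForm.
Variables (K : fieldType) (n : nat).

Definition dot (u v : 'rV[K]_n) : K := \sum_i u 0 i * v 0 i.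

Fact dot_bilinear : bilinear_for *%R *%R dot.
Proof.
split=> w a u v /=; rewrite /dot mulr_sumr -big_split /=; apply: eq_bigr => i _.
  by rewrite !mxE mulrDl mulrA.
by rewrite !mxE mulrDr mulrCA.
Qed.

HB.instance Definition _ := bilinear_isBilinear.Build K 'rV[K]_n 'rV[K]_n K *%R *%R dot dot_bilinear.

Fact dot_sym u v : dot u v = (-1) ^+ false * idfun (dot v u).
Proof. by rewrite mul1r; apply: eq_bigr => i _; rewrite mulrC. Qed.

HB.instance Definition _ := isHermitianSesquilinear.Build K 'rV[K]_n false idfun dot dot_sym.
End StandardForm.

Section RestrictedForm.
Variables (K : fieldType) (V : vectType K) (f : {symmetric V}).
Variable U : {vspace V}.

Definition restr (u v : subvs_of U) : K := f (vsval u) (vsval v).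

Fact restr_bilinear : bilinear_for *%R *%R restr.
Proof.
by split=> w a u v; rewrite /restr linearP ?linearPl ?linearPr.
Qed.

HB.instance Definition _ := bilinear_isBilinear.Build K (subvs_of U) (subvs_of U) K
  *%R *%R restr restr_bilinear.

Fact restr_sym u v : restr u v = (-1) ^+ false * idfun (restr v u).
Proof. exact: hermitian_subproof. Qed.

HB.instance Definition _ :=
  isHermitianSesquilinear.Build K (subvs_of U) false idfun restr restr_sym.
End RestrictedForm.

Definition oproj (K : fieldType) (V : vectType K) (f : {symmetric V})
    (U : {vspace V}) : 'End(V) := daddv_pi U (orthov f U).

Definition nondegenerate_on (K : fieldType) (V : vectType K) (f : {symmetric V})
    (U : {vspace V}) : Prop := (U :&: orthov f U = 0)%VS.

Record arrangement (K : fieldType) (V : vectType K) (n : nat) := Arrangement {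
  form : {symmetric V};
  nu : 'I_n -> V;
  pos : {set 'I_n}
}.

Section Arrangement.
Variables (K : fieldType) (V : vectType K) (n : nat) (A : arrangement V n).
Implicit Type S U : {set 'I_n}.

Definition Hsp S : {vspace V} := (\bigcap_(s in S) orthov (form A) <[nu A s]>)%VS.

Definition Vsp S : {vspace V} := (\sum_(s in S) <[nu A s]>)%VS.

Definition lincomb_fun (w : 'rV[K]_n) : V := \sum_i w 0 i *: nu A i.

Fact lincomb_fun_linear : linear lincomb_fun.
Proof.
move=> a u v; rewrite /lincomb_fun scaler_sumr -big_split /=.
by apply: eq_bigr => i _; rewrite !mxE scalerDl scalerA.
Qed.

HB.instance Definition _ :=
  GRing.isLinear.Build K 'rV[K]_n V _ lincomb_fun lincomb_fun_linear.

Definition lincomb : 'Hom('rV[K]_n, V) := linfun lincomb_fun.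

Definition outside_fun S (w : 'rV[K]_n) : 'rV[K]_n :=
  \row_i (if i \in S then 0 else w 0 i).

Fact outside_fun_linear S : linear (outside_fun S).
Proof.
move=> a u v; apply/rowP=> i; rewrite !mxE.
by case: ifP => // _; rewrite mulr0 addr0.
Qed.

HB.instance Definition _ S :=
  GRing.isLinear.Build K 'rV[K]_n 'rV[K]_n _ (outside_fun S) (outside_fun_linear S).

Definition Wsp S : {vspace 'rV[K]_n} :=
  (lker lincomb :&: lker (linfun (outside_fun S)))%VS.

Definition nuv (r : 'I_n) : 'rV[K]_n := oproj (@dot K n) (Wsp setT) (delta_mx 0 r).

Definition tilde S : {set 'I_n} := (S :&: pos A) :|: (~: pos A :\: S).

(* All orthogonal projections used below are projections onto some H_S or W_S;  *)
(* for S empty this says that the form is nondegenerate on V = H_set0.          *)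
Definition regular : Prop :=
  forall S, nondegenerate_on (form A) (Hsp S) /\ nondegenerate_on (@dot K n) (Wsp S).

Definition Hproj U : 'End(ext V) := extmap (oproj (form A) (Hsp U)).

Definition Wproj U : 'End(ext 'rV[K]_n) := extmap (oproj (@dot K n) (Wsp U)).

Definition wedge_nu (r : 'I_n) U : 'End(ext V) :=
  lwedge (oproj (form A) (Hsp U) (nu A r)).

Definition wedge_nuv (r : 'I_n) U : 'End(ext 'rV[K]_n) :=
  lwedge (oproj (@dot K n) (Wsp U) (nuv r)).

(* H_(tilde S), its exterior algebra and the W's all sit in fixed ambient       *)
(* spaces, so that inclusions are \1.                                           *)
Definition delta S (r : 'I_n) : 'End(tens V 'rV[K]_n) :=
  let U := tilde S in
  if r \in pos A then
    if nu A r \notin Vsp U then tmap (Hproj (r |: U)) \1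
    else tmap (Hproj (r |: U)) (wedge_nuv r (r |: U))
  else
    if nu A r \in Vsp (U :\ r) then tmap \1 (Wproj (U :\ r))
    else tmap (wedge_nu r (U :\ r)) (Wproj (U :\ r)).

Definition Tcube : cube K n :=
  @Cube K n (tens V 'rV[K]_n)
    (fun S => \dim (Hsp (tilde S)) + \dim (Wsp (tilde S)))%N
    (fun S k => \sum_(i < k.+1)
       tensv (extpow (Hsp (tilde S)) i) (extpow (Wsp (tilde S)) (k - i)))%VS
    delta.

End Arrangement.

Section DeletionContraction.
Variables (K : fieldType) (V : vectType K) (n : nat) (A : arrangement V n.+1).
Variable l : 'I_n.+1.

Definition other_pos : {set 'I_n} := [set i | lift l i \in pos A].

Definition deletion : arrangement V n :=
  Arrangement (form A) (fun i => nu A (lift l i)) other_pos.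

Definition perp : {vspace V} := orthov (form A) <[nu A l]>.

Definition contraction : arrangement (subvs_of perp) n :=
  Arrangement (restr (form A) (U := perp) : {symmetric (subvs_of perp)})
    (fun i => vsproj perp (oproj (form A) perp (nu A (lift l i)))) other_pos.

Definition insert0_fun (w : 'rV[K]_n) : 'rV[K]_n.+1 :=
  \row_i (if unlift l i is Some j then w 0 j else 0).

Fact insert0_fun_linear : linear insert0_fun.
Proof.
move=> a u v; apply/rowP=> i; rewrite !mxE.
by case: unlift => [j|]; rewrite ?mxE // mulr0 addr0.
Qed.

HB.instance Definition _ :=
  GRing.isLinear.Build K 'rV[K]_n 'rV[K]_n.+1 _ insert0_fun insert0_fun_linear.

(* The relation sum_(j != l) w_j nu_j in <[nu_l]> between the projected vectors *)
(* is completed to a relation between all nu_i: pairing with nu_l gives w_l.    *)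
Definition complete_rel_fun (w : 'rV[K]_n) : 'rV[K]_n.+1 :=
  \row_i (if unlift l i is Some j then w 0 j else
    - (form A (lincomb deletion w) (nu A l) / form A (nu A l) (nu A l))).

Fact complete_rel_fun_linear : linear complete_rel_fun.
Proof.
move=> a u v; apply/rowP=> i; rewrite !mxE.
case: unlift => [j|]; rewrite ?mxE // linearP linearPl /=.
by rewrite mulrDl opprD mulrN mulrA.
Qed.

HB.instance Definition _ := GRing.isLinear.Build K 'rV[K]_n 'rV[K]_n.+1 _
  complete_rel_fun complete_rel_fun_linear.

Definition del_ident : 'Hom(tens V 'rV[K]_n, tens V 'rV[K]_n.+1) :=
  tmap \1 (extmap (linfun insert0_fun)).

Definition con_ident : 'Hom(tens (subvs_of perp) 'rV[K]_n, tens V 'rV[K]_n.+1) :=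
  tmap (extmap (linfun vsval)) (extmap (linfun complete_rel_fun)).

Record identified := Identified {
  icube : cube K n;
  ident : 'Hom(amb icube, amb (Tcube A))
}.

(* The complex of the contraction, with the identification of its vertex S with *)
(* Lambda H_(U u l) (x) Lambda W_(U u l). When nu_l = 0 the relation spaces of  *)
(* the contraction are W_U, one dimension smaller than W_(U u l), so that no    *)
(* such identification exists; the summands are then taken to be these spaces   *)
(* themselves, i.e. the vertices of Tcube A at which l belongs to tilde S.      *)
Definition con : identified :=
  if nu A l == 0
  then Identified (facet_ident (Tcube A) l (l \in pos A))
  else @Identified (Tcube contraction) con_ident.

Definition gamma_plus (S : {set 'I_n}) : 'End(tens V 'rV[K]_n.+1) :=
  let U := tilde A (lift l @: S) in
  if nu A l \notin Vsp A U then tmap (Hproj A (l |: U)) \1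
  else tmap (Hproj A (l |: U)) (wedge_nuv A l (l |: U)).

Definition gamma_minus (S : {set 'I_n}) : 'End(tens V 'rV[K]_n.+1) :=
  let U := tilde A (lift l @: S) in
  if nu A l \notin Vsp A (U :\ l) then tmap (wedge_nu A l (U :\ l)) (Wproj A (U :\ l))
  else tmap \1 (Wproj A (U :\ l)).

(* x (x) y at vertex S is carried to Tcube A by the identifications, mapped,    *)
(* and carried back to the target complex.                                      *)
Definition gamma_plus_cochain (z : cochain (Tcube deletion)) : cochain (icube con) :=
  [ffun S => (ident con)^-1%VF (gamma_plus S (del_ident (z S)))].

Definition gamma_minus_cochain (z : cochain (icube con)) : cochain (Tcube deletion) :=
  [ffun S => del_ident^-1%VF (gamma_minus S (ident con (z S)))].

End DeletionContraction.
Arguments gamma_plus_cochain {K V n} A l z.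
Arguments gamma_minus_cochain {K V n} A l z.

Section LongExactSequence.
Variables (K : fieldType) (m n p : nat).
Variables (Q1 : cube K m) (eps1 : scalars K m).
Variables (Q : cube K n) (eps : scalars K n).
Variables (Q2 : cube K p) (eps2 : scalars K p).

Definition chain_map (a b : nat) (P : cube K a) (P' : cube K b) (e : scalars K a)
    (e' : scalars K b) (f : 'Hom(cochain P, cochain P')) : Prop :=
  {in total P, forall t, f (diff P e t) = diff P' e' (f t)}.

Definition short_exact (f : 'Hom(cochain Q1, cochain Q))
    (g : 'Hom(cochain Q, cochain Q2)) : Prop :=
  [/\ (lker f :&: total Q1 = 0)%VS,
      (f @: total Q1 = lker g :&: total Q)%VS &
      (g @: total Q = total Q2)%VS].

(* The long exact homology sequence of a short exact sequence of complexes      *)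
(* 0 -> Q1 -> Q -> Q2 -> 0, where alpha and beta have bidegree (1/2, 1/2), the   *)
(* connecting map gamma of the snake lemma has bidegree (0, -1) and is induced  *)
(* by c on cycles. The shifts are those of |S| - n/2 when one vector is dropped *)
(* and S loses an element (Q1) or does not (Q2).                                *)
Definition long_exact (c : cochain Q2 -> cochain Q1) : Prop :=
  exists (f : 'Hom(cochain Q1, cochain Q)) (g : 'Hom(cochain Q, cochain Q2))
         (alpha : 'Hom(homology Q1 eps1, homology Q eps))
         (beta : 'Hom(homology Q eps, homology Q2 eps2))
         (gamma : 'Hom(homology Q2 eps2, homology Q1 eps1)),
  [/\ chain_map eps1 eps f, chain_map eps eps2 g & short_exact f g] /\
  [/\ {in cycles Q1 eps1, forall z, alpha (hclass Q1 eps1 z) = hclass Q eps (f z)},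
      {in cycles Q eps, forall z, beta (hclass Q eps z) = hclass Q2 eps2 (g z)} &
      {in cycles Q2 eps2, forall z,
         [/\ c z \in cycles Q1 eps1,
             gamma (hclass Q2 eps2 z) = hclass Q1 eps1 (c z) &
             exists2 t, t \in total Q & g t = z /\ diff Q eps t = f (c z)]}] /\
  forall i q : rat,
  [/\ (alpha @: HKh Q1 eps1 (i - 1 / 2) (q - 1 / 2)
         = lker beta :&: HKh Q eps i q)%VS,
      (beta @: HKh Q eps i q
         = lker gamma :&: HKh Q2 eps2 (i + 1 / 2) (q + 1 / 2))%VS &
      (gamma @: HKh Q2 eps2 (i + 1 / 2) (q + 1 / 2)
         = lker alpha :&: HKh Q1 eps1 (i + 1 / 2) (q - 1 / 2))%VS].

End LongExactSequence.
Arguments long_exact {K m n p} Q1 eps1 Q eps Q2 eps2 c.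

(* Main.v *)
Require Import Defs.
From HB Require Import structures.
From mathcomp Require Import all_boot all_order all_algebra.
From mathcomp Require Import ring.

Set Implicit Arguments.
Unset Strict Implicit.
Unset Printing Implicit Defensive.

Import GRing.Theory.
Local Open Scope ring_scope.

(** Fixing whether l belongs to S cuts the cube of A into two facets.  The
    subsets containing l form a subcomplex and the others the quotient, so the
    snake lemma gives a long exact sequence whose connecting map is the part of
    the differential that crosses from one facet to the other, that is, the
    l-th edge maps; by definition these are gamma_plus and gamma_minus
    ([long_exact_snake], [facet_long_exact]).  It remains to identify the
    facets: where l is absent from tilde S one finds the complex of the
    deletion, where it is present that of the contraction.

    For the deletion, extending relations by zero is isometric and commutes
    with every edge ([del_facet_iso]).  For the contraction there is an
    obstacle: completing a relation between the projected vectors to one between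
    the nu_i is a bijection of relation spaces iota : W'_U -> W_(U u l), but not
    an isometry, because it adds an l-th coordinate.  As the edges involve
    orthogonal projections and the vectors nu_r^vee, iota does not commute with
    them.  What commutes with them is the inverse phi_U of the adjoint of iota,
    characterized by < phi_U x, iota y > = < x, y >.  Indeed, identify W_U with
    its dual space: orthogonal projection becomes restriction of functionals,
    nu_r^vee becomes the r-th coordinate functional, and the inclusion of W_U
    becomes an extension of functionals, whose ambiguity is a multiple of the
    r-th coordinate and dies in the wedge product with it.  None of this refers
    to an inner product.  It is carried out for any such pair iota, phi in
    [cmp_facet_iso].  If nu_l = 0, the complex of the contraction is the facet
    itself and nothing has to be corrected.

    The two identifications differ by a rank one correction: phi_U is iota
    followed by the shear x |-> x - x_l omega, where omega is the projection of
    nu_l^vee to W_(U u l).  The shear is the identity on W_U and multiplies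
    omega by 1 - omega_l, which is nonzero because the form on W'_U is
    nondegenerate.  Hence on the image of the l-th edge map it is a scalar
    ([shear_edge_pos]), and it is invisible after projecting to W_U
    ([shear_edge_neg]).  So replacing iota by phi changes the connecting map
    only by a nonzero scalar at each vertex, and this is absorbed into the
    scalars epsilon of the subcomplex, which change by a coboundary
    ([facet_eps], [cross_scaling]).

    The rest is bookkeeping: functoriality of exterior powers and of their
    tensor products, and the fact that edges preserve the q-degree
    ([edge_piece]), which makes the sequence exact in each bidegree. *)

(** Off-diagonal terms cancel in pairs; splitting the sum along an order of the
    index set makes this valid in characteristic 2 as well. *)
Lemma sum_antisym (W : zmodType) (I : finType) (P : pred I) (a : I -> I -> W) :
  (forall r s, P r -> P s -> r != s -> a r s + a s r = 0) ->
  \sum_(r | P r) \sum_(s | P s && (s != r)) a r s = 0.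
Proof.
move=> anti; pose lt (s r : I) := (enum_rank s < enum_rank r)%N.
have neq_lt s r : (s != r) = lt s r || lt r s.
  by rewrite -(inj_eq enum_rank_inj) /lt -neq_ltn.
have lt_asym s r : lt s r -> ~~ lt r s by rewrite /lt -leqNgt; apply: ltnW.
transitivity (\sum_(r | P r) \sum_(s | P s && lt s r) a r s +
              \sum_(r | P r) \sum_(s | P s && lt r s) a r s).
  rewrite -big_split; apply: eq_bigr => r _ /=.
  rewrite (bigID (fun s => lt s r)) /=; congr (_ + _); apply: eq_bigl => s;
    rewrite neq_lt -andbA; case: (boolP (lt s r)); rewrite ?andbT //= ?andbF //.
  by move/lt_asym/negPf->; rewrite andbF.
rewrite [X in _ + X](exchange_big_dep P) /= => [|r s _ /andP[]//].
rewrite -big_split big1 // => r Pr /=.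
rewrite [X in _ + X](eq_bigl (fun s => P s && lt s r)); last first.
  by move=> s; rewrite Pr.
rewrite -big_split big1 // => s /andP[Ps lt_sr] /=.
by apply: anti; rewrite // eq_sym neq_lt lt_sr.
Qed.

(** * Bigraded cochain complexes of cubes *)

Section CubeComplex.
Variables (K : fieldType) (n : nat) (Q : cube K n).
Implicit Types (S : {set 'I_n}) (t : cochain Q) (j q : rat).

Definition qpiece S q : {vspace amb Q} :=
  (\sum_(k < (topdeg Q S).+1 | qdeg Q S k == q) piece Q S k)%VS.

Lemma cochain0 S : (0 : cochain Q) S = 0. Proof. by rewrite ffunE. Qed.

Lemma injE S x : inj Q S x = inj_fun S x. Proof. by rewrite lfunE. Qed.

Lemma sub_qpiece_vertex S q : (qpiece S q <= vertex Q S)%VS.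
Proof. by apply/subv_sumP => k _; apply: (sumv_sup k). Qed.

Lemma sum_injP (X : {set 'I_n} -> {vspace amb Q}) t :
  reflect (forall S, t S \in X S) (t \in \sum_S inj Q S @: X S)%VS.
Proof.
apply: (iffP memv_sumP) => [[u Xu ->] S | Xt].
  rewrite sum_ffunE (bigD1 S) //= big1 ?addr0 => [|S' neqS].
    by have /memv_imgP[v Xv ->] := Xu S isT; rewrite injE ffunE eqxx.
  have /memv_imgP[v _ ->] := Xu S' isT.
  by rewrite injE ffunE eq_sym (negPf neqS).
exists (fun S => inj Q S (t S)) => [S _|]; first exact: memv_img.
apply/ffunP=> S; rewrite sum_ffunE (bigD1 S) //= big1 ?addr0 => [|S' neqS].
  by rewrite injE ffunE eqxx.
by rewrite injE ffunE eq_sym (negPf neqS).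
Qed.

Lemma totalP t : reflect (forall S, t S \in vertex Q S) (t \in Defs.total Q).
Proof. exact: sum_injP. Qed.

Lemma bipieceE j q : bipiece Q j q =
  (\sum_S inj Q S @: (if hdeg S == j then qpiece S q else 0))%VS.
Proof.
rewrite /bipiece big_mkcond; apply: eq_bigr => S _.
by case: eqP => _; rewrite ?limg0 // limg_sum.
Qed.

Lemma bipieceP j q t :
  reflect (forall S, t S \in (if hdeg S == j then qpiece S q else 0)%VS)
          (t \in bipiece Q j q).
Proof. by rewrite bipieceE; apply: sum_injP. Qed.

Lemma sub_bipiece_total j q : (bipiece Q j q <= Defs.total Q)%VS.
Proof.
apply/subvP=> t /bipieceP Pt; apply/totalP=> S; have := Pt S.
case: ifP => _; first exact: subvP (sub_qpiece_vertex _ _) _.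
by rewrite memv0 => /eqP->; apply: mem0v.
Qed.

(** Projections pi S q of the vertices onto their pieces of fixed q-degree,
    commuting with the edges: they say at once that the q-degree is a grading
    of each vertex and that edges preserve it. *)
Definition qgrading (pi : {set 'I_n} -> rat -> 'End(amb Q)) : Prop :=
  forall S, {in vertex Q S, forall x,
    [/\ forall q, pi S q x \in qpiece S q,
        forall q, x \in qpiece S q -> pi S q x = x &
        forall r, r \notin S -> edge Q S r x \in vertex Q (r |: S) /\
          forall q, pi (r |: S) q (edge Q S r x) = edge Q S r (pi S q x)]}.

Lemma piece_qgrading (pi : {set 'I_n} -> rat -> 'End(amb Q)) :
  (forall S q k x, (k <= topdeg Q S)%N -> x \in piece Q S k ->
     pi S q x = if qdeg Q S k == q then x else 0) ->
  (forall S r k, r \notin S -> (k <= topdeg Q S)%N ->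
     (edge Q S r @: piece Q S k <= qpiece (r |: S) (qdeg Q S k))%VS) ->
  qgrading pi.
Proof.
move=> pi_piece edge_piece S x Vx.
have pi_q S' q q' y : y \in qpiece S' q -> pi S' q' y = if q == q' then y else 0.
  case/memv_sumP=> u Pu ->; rewrite linear_sum /=.
  rewrite (eq_bigr (fun k => if q == q' then u k else 0)) => [|k qk].
    by case: ifP => // _; rewrite big1.
  have /= Puk := Pu k qk; rewrite (pi_piece _ _ k _ _ Puk); last by rewrite -ltnS.
  by rewrite (eqP qk).
have [u Pu defx] := memv_sumP Vx.
have pi_u q (k : 'I_(topdeg Q S).+1) :
    pi S q (u k) = if qdeg Q S k == q then u k else 0.
  by rewrite (pi_piece _ _ k _ _ (Pu k isT)) // -ltnS.
have pi_x q : pi S q x = \sum_(k < (topdeg Q S).+1 | qdeg Q S k == q) u k.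
  rewrite defx linear_sum [RHS]big_mkcond.
  by apply: eq_bigr => k _; rewrite /= pi_u.
have e_u r (k : 'I_(topdeg Q S).+1) : r \notin S ->
    edge Q S r (u k) \in qpiece (r |: S) (qdeg Q S k).
  move=> Sr; apply: subvP (memv_img _ (Pu k isT)).
  by apply: edge_piece; rewrite // -ltnS.
split=> [q | q | r Sr].
- rewrite pi_x; apply: memv_suml => k qk.
  by apply: subvP (Pu k isT); apply: (sumv_sup k).
- by move/pi_q->; rewrite eqxx.
split=> [|q].
  rewrite defx linear_sum; apply: memv_suml => k _.
  exact: subvP (sub_qpiece_vertex _ _) _ (e_u r k Sr).
rewrite pi_x defx !linear_sum [RHS]big_mkcond; apply: eq_bigr => k _ /=.
exact: pi_q (e_u r k Sr).
Qed.

Definition bipart (pi : {set 'I_n} -> rat -> 'End(amb Q)) j q t : cochain Q :=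
  [ffun S => if hdeg S == j then pi S q (t S) else 0].

Section Graded.
Variables (eps : scalars K n) (pi : {set 'I_n} -> rat -> 'End(amb Q)).
Hypothesis pi_gr : qgrading pi.

Lemma diffE t S : diff Q eps t S =
  \sum_(r in S) eps (S :\ r) r *: edge Q (S :\ r) r (t (S :\ r)).
Proof. by rewrite lfunE /= ffunE. Qed.

Lemma edge_vertex S r x : r \notin S -> x \in vertex Q S ->
  edge Q S r x \in vertex Q (r |: S).
Proof. by move=> Sr /pi_gr[_ _ /(_ r Sr)[]]. Qed.

Lemma diff_total t : t \in Defs.total Q -> diff Q eps t \in Defs.total Q.
Proof.
move/totalP=> Tt; apply/totalP=> S; rewrite diffE; apply: memv_suml => r Sr.
have nSr: r \notin S :\ r by rewrite !inE eqxx.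
by apply: memvZ; have := edge_vertex nSr (Tt _); rewrite setD1K.
Qed.

Lemma bipart_bipiece j q t : t \in Defs.total Q ->
  bipart pi j q t \in bipiece Q j q.
Proof.
move/totalP=> Tt; apply/bipieceP=> S; rewrite ffunE.
by case: ifP => _; rewrite ?mem0v //; case/pi_gr: (Tt S).
Qed.

Lemma bipart_id j q t : t \in bipiece Q j q -> bipart pi j q t = t.
Proof.
move=> Pt; have /totalP Tt := subvP (sub_bipiece_total j q) _ Pt.
move/bipieceP in Pt; apply/ffunP=> S; rewrite ffunE.
move: (Pt S); case: ifP => _; last by rewrite memv0 => /eqP->.
by case/pi_gr: (Tt S) => _ pi_id _ /pi_id.
Qed.

Lemma hdegS S r : r \in S -> hdeg S = hdeg (S :\ r) + 1.
Proof. by move=> Sr; rewrite /hdeg (cardsD1 r S) Sr /= natrD -addrA addrC. Qed.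

Lemma bipart_diff j q t : t \in Defs.total Q ->
  bipart pi (j + 1) q (diff Q eps t) = diff Q eps (bipart pi j q t).
Proof.
move/totalP=> Tt; apply/ffunP=> S; rewrite ffunE !diffE.
case: ifP => hS.
  rewrite linear_sum; apply: eq_bigr => r Sr; rewrite linearZ /= ffunE.
  rewrite (hdegS Sr) (inj_eq (addIr 1)) in hS; rewrite hS.
  have nSr: r \notin S :\ r by rewrite !inE eqxx.
  by case/pi_gr: (Tt (S :\ r)) => _ _ /(_ r nSr)[_ <-]; rewrite (setD1K Sr).
rewrite big1 // => r Sr; rewrite ffunE.
by rewrite (hdegS Sr) (inj_eq (addIr 1)) in hS; rewrite hS linear0 scaler0.
Qed.

(** The two orders in which r and s can be added to S minus r minus s are the
    sides of an anticommuting square. *)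
Lemma diff_diff t : anticommuting Q eps -> t \in Defs.total Q ->
  diff Q eps (diff Q eps t) = 0.
Proof.
move=> [_ sq0] /totalP Tt; apply/ffunP=> S; rewrite cochain0 diffE.
pose a r s := eps (S :\ r) r *: edge Q (S :\ r) r (eps (S :\ r :\ s) s *:
  edge Q (S :\ r :\ s) s (t (S :\ r :\ s))).
transitivity (\sum_(r in S) \sum_(s | (s \in S) && (s != r)) a r s).
  apply: eq_bigr => r Sr; rewrite diffE !linear_sum.
  by apply: eq_big => s; rewrite ?inE // andbC.
apply: sum_antisym => r s Sr Ss neq_rs; pose S' := S :\ r :\ s.
have eqS: S :\ s :\ r = S' by rewrite /S' !setDDl setUC.
have eqr: S :\ r = s |: S' by rewrite setD1K // !inE eq_sym neq_rs.
have eqs: S :\ s = r |: S' by rewrite -eqS setD1K // !inE neq_rs.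
have nr: r \notin S' by rewrite !inE eqxx andbF.
have ns: s \notin S' by rewrite !inE eqxx.
have := sq0 S' s r ns nr; rewrite eq_sym => /(_ neq_rs (t S') (Tt S')).
by rewrite -eqr -eqs /a eqS -/S'.
Qed.

Section Homology.
Hypothesis eps_ok : anticommuting Q eps.

Lemma sub_boundaries_cycles : (boundaries Q eps <= cycles Q eps)%VS.
Proof.
apply/subvP=> _ /memv_imgP[t Tt ->].
by rewrite memv_cap diff_total //= memv_ker diff_diff.
Qed.

Lemma cyclesP t :
  reflect (t \in Defs.total Q /\ diff Q eps t = 0) (t \in cycles Q eps).
Proof.
by rewrite memv_cap memv_ker; apply: (iffP andP) => -[Tt /eqP dt].
Qed.

Lemma hclass_diff t : t \in Defs.total Q -> hclass Q eps (diff Q eps t) = 0.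
Proof.
move=> Tt; apply/eqP; rewrite hclass_eq0 ?sub_boundaries_cycles ?memv_img //.
exact: subvP sub_boundaries_cycles _ (memv_img _ Tt).
Qed.

Lemma hclass_eq0P z : z \in cycles Q eps -> hclass Q eps z = 0 ->
  exists2 t, t \in Defs.total Q & z = diff Q eps t.
Proof.
move=> Zz /eqP; rewrite hclass_eq0 ?sub_boundaries_cycles //.
by move/memv_imgP.
Qed.

Lemma hclassK z : z \in cycles Q eps ->
  exists2 t, t \in Defs.total Q & vsval (hclass Q eps z) = z + diff Q eps t.
Proof.
move=> Zz; have zZB: z \in (cycles Q eps :\: boundaries Q eps +
    boundaries Q eps)%VS.
  by rewrite addv_diff (addv_idPl sub_boundaries_cycles).
have := addv_pi1_pi2 (U := cycles Q eps) (V := boundaries Q eps) (w := z).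
rewrite (addv_idPl sub_boundaries_cycles) => /(_ Zz).
have /memv_imgP[t Tt ->] := memv_pi2 (cycles Q eps) (boundaries Q eps) z.
move=> defz; exists (- t); first by rewrite memvN.
rewrite linearN /= /hclass lfunE /= /hclass_fun vsprojK; last exact: memv_pi.
by apply/eqP; rewrite eq_sym subr_eq defz.
Qed.

Lemma HKhP h j q : reflect
  (exists z, [/\ z \in bipiece Q j q, diff Q eps z = 0 & h = hclass Q eps z])
  (h \in HKh Q eps j q).
Proof.
apply: (iffP memv_imgP) => [[z] | [z [Pz dz ->]]].
  by rewrite memv_cap memv_ker => /andP[Pz /eqP dz] ->; exists z.
by exists z; rewrite // memv_cap memv_ker dz eqxx andbT.
Qed.

End Homology.
End Graded.
End CubeComplex.

(** * The long exact sequence of a short exact sequence of cube complexes *)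

Section LongExact.
Variables (K : fieldType) (m n p : nat).
Variables (Q1 : cube K m) (eps1 : scalars K m).
Variable pi1 : {set 'I_m} -> rat -> 'End(amb Q1).
Variables (Q : cube K n) (eps : scalars K n).
Variable pi : {set 'I_n} -> rat -> 'End(amb Q).
Variables (Q2 : cube K p) (eps2 : scalars K p).
Variable pi2 : {set 'I_p} -> rat -> 'End(amb Q2).
Hypotheses (gr1 : qgrading pi1) (gr : qgrading pi) (gr2 : qgrading pi2).
Hypotheses (ok1 : anticommuting Q1 eps1) (ok : anticommuting Q eps)
  (ok2 : anticommuting Q2 eps2).
Variables (f : 'Hom(cochain Q1, cochain Q)) (g : 'Hom(cochain Q, cochain Q2)).
Variable c : {linear cochain Q2 -> cochain Q1}.
Hypotheses (f_chain : chain_map eps1 eps f) (g_chain : chain_map eps eps2 g).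
Hypothesis fg_exact : short_exact f g.
Hypothesis f_bipart : forall j q, {in Defs.total Q1, forall t,
  f (bipart pi1 j q t) = bipart pi (j + 1 / 2) (q + 1 / 2) (f t)}.
Hypothesis g_bipart : forall j q, {in Defs.total Q, forall t,
  g (bipart pi j q t) = bipart pi2 (j + 1 / 2) (q + 1 / 2) (g t)}.
Hypothesis c_lift : {in cycles Q2 eps2, forall z, c z \in Defs.total Q1 /\
  exists2 t, t \in Defs.total Q & g t = z /\ diff Q eps t = f (c z)}.

Let f_total t : t \in Defs.total Q1 -> f t \in Defs.total Q.
Proof.
case: fg_exact => _ fT _ /(memv_img f); rewrite fT.
by move/memv_capP=> [].
Qed.

Let gf0 t : t \in Defs.total Q1 -> g (f t) = 0.
Proof.
case: fg_exact => _ fT _ /(memv_img f); rewrite fT memv_cap memv_ker.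
by case/andP=> /eqP.
Qed.

Let f_inj t u : t \in Defs.total Q1 -> u \in Defs.total Q1 -> f t = f u -> t = u.
Proof.
move=> Tt Tu eq_f; have [ker0 _ _] := fg_exact; apply/eqP.
rewrite -subr_eq0 -memv0 -ker0 memv_cap memv_ker linearB /= eq_f subrr eqxx.
exact: memvB.
Qed.

Let g_ker t : t \in Defs.total Q -> g t = 0 ->
  exists2 u, u \in Defs.total Q1 & t = f u.
Proof.
move=> Tt gt0; apply/memv_imgP; case: fg_exact => _ -> _.
by rewrite memv_cap memv_ker gt0 eqxx.
Qed.

Let g_total t : t \in Defs.total Q -> g t \in Defs.total Q2.
Proof. by case: fg_exact => _ _ <- Tt; apply: memv_img. Qed.

Let g_surj z : z \in Defs.total Q2 -> exists2 t, t \in Defs.total Q & z = g t.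
Proof. by case: fg_exact => _ _ <- /memv_imgP. Qed.

Let f_cycle z : z \in cycles Q1 eps1 -> f z \in cycles Q eps.
Proof.
case/cyclesP=> Tz dz; apply/cyclesP; split; first exact: f_total.
by rewrite -f_chain // dz linear0.
Qed.

Let g_cycle z : z \in cycles Q eps -> g z \in cycles Q2 eps2.
Proof.
case/cyclesP=> Tz dz; apply/cyclesP; split; first exact: g_total.
by rewrite -g_chain // dz linear0.
Qed.

Let c_cycle z : z \in cycles Q2 eps2 -> c z \in cycles Q1 eps1.
Proof.
move=> Zz; have [Tcz [t Tt [_ dt]]] := c_lift Zz.
apply/cyclesP; split=> //; apply: f_inj; rewrite ?mem0v ?(diff_total eps1 gr1) //.
by rewrite f_chain // -dt diff_diff // linear0.
Qed.

(** The class of c z depends only on the class of z: if z bounds y, then a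
    lift of z differs from the coboundary of a lift of y by f w, and the
    coboundary of f w is f (c z). *)
Let c_boundary z : z \in cycles Q2 eps2 -> hclass Q2 eps2 z = 0 ->
  hclass Q1 eps1 (c z) = 0.
Proof.
move=> Zz /(hclass_eq0P gr2 ok2 Zz)[y Ty defz].
have [Tcz [t Tt [gt dt]]] := c_lift Zz; have [x Tx defy] := g_surj Ty.
have Tdx := diff_total eps gr Tx.
have [||w Tw defw] := @g_ker (t - diff Q eps x); first exact: memvB.
  by rewrite linearB /= g_chain // -defy -defz gt subrr.
rewrite -(@f_inj (diff Q1 eps1 w) (c z)) ?(diff_total eps1 gr1) //.
  exact: (hclass_diff gr1).
by rewrite f_chain // -defw linearB /= diff_diff // subr0.
Qed.

Let indh (n1 n2 : nat) (P1 : cube K n1) (e1 : scalars K n1) (P2 : cube K n2)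
    (e2 : scalars K n2) (h : {linear cochain P1 -> cochain P2}) :
    'Hom(homology P1 e1, homology P2 e2) :=
  linfun (hclass P2 e2 \o h \o vsval).

Let indhE n1 n2 (P1 : cube K n1) e1 (P2 : cube K n2) e2
    (h : {linear cochain P1 -> cochain P2}) p1 :
  qgrading (Q := P1) p1 -> anticommuting P1 e1 ->
  {in cycles P1 e1, forall z, h z \in cycles P2 e2} ->
  {in cycles P1 e1, forall z, hclass P1 e1 z = 0 -> hclass P2 e2 (h z) = 0} ->
  {in cycles P1 e1, forall z,
    indh e1 e2 h (hclass P1 e1 z) = hclass P2 e2 (h z)}.
Proof.
move=> gr' ok' hZ hB z Zz; rewrite lfunE /=.
have [t Tt ->] := hclassK gr' ok' Zz; have Tdt := memv_img (diff P1 e1) Tt.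
have Zdt := subvP (sub_boundaries_cycles gr' ok') _ Tdt.
by rewrite !linearD /= [X in _ + X]hB ?addr0 // (hclass_diff gr').
Qed.

Theorem long_exact_snake : long_exact Q1 eps1 Q eps Q2 eps2 c.
Proof.
have halves (q : rat) : q - 1 / 2 + 1 / 2 = q by rewrite subrK.
pose alpha := indh eps1 eps f; pose beta := indh eps eps2 g.
pose gamma := indh eps2 eps1 c.
have alphaE : {in cycles Q1 eps1, forall z,
    alpha (hclass Q1 eps1 z) = hclass Q eps (f z)}.
  apply: (indhE gr1 ok1) => // z Zz /(hclass_eq0P gr1 ok1 Zz)[t Tt ->].
  by rewrite /= f_chain // (hclass_diff gr) // f_total.
have betaE : {in cycles Q eps, forall z,
    beta (hclass Q eps z) = hclass Q2 eps2 (g z)}.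
  apply: (indhE gr ok) => // z Zz /(hclass_eq0P gr ok Zz)[t Tt ->].
  by rewrite /= g_chain // (hclass_diff gr2) // g_total.
have gammaE : {in cycles Q2 eps2, forall z,
    gamma (hclass Q2 eps2 z) = hclass Q1 eps1 (c z)}.
  exact: (indhE gr2 ok2).
have bip_cycle n0 (P : cube K n0) e j q z :
    z \in bipiece P j q -> diff P e z = 0 -> z \in cycles P e.
  move=> Pz dz; apply/cyclesP; split=> //.
  exact: subvP (sub_bipiece_total P j q) _ Pz.
exists f, g, alpha, beta, gamma; split=> //; split.
  by split=> // z Zz; have [Tcz t_z] := c_lift Zz; split; rewrite ?gammaE ?c_cycle.
move=> i q; split; apply/eqP; rewrite eqEsubv; apply/andP; split; apply/subvP.
- move=> h /memv_imgP[h1 /HKhP[z [Pz dz defh1]] ->]; rewrite {h1}defh1.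
  have Zz := bip_cycle _ _ _ _ _ _ Pz dz; have [Tz _] := cyclesP _ _ Zz.
  rewrite alphaE // memv_cap memv_ker betaE ?f_cycle // gf0 // linear0 eqxx /=.
  apply/HKhP; exists (f z); split=> //; last by rewrite -f_chain // dz linear0.
  rewrite -(bipart_id gr1 Pz) f_bipart // !halves.
  by rewrite (bipart_bipiece gr) // f_total.
- move=> h /memv_capP[kerh /HKhP[z [Pz dz defh]]]; move: kerh; rewrite {h}defh.
  have Zz := bip_cycle _ _ _ _ _ _ Pz dz; have [Tz _] := cyclesP _ _ Zz.
  rewrite memv_ker betaE // => /eqP/(hclass_eq0P gr2 ok2 (g_cycle Zz))[y Ty gz].
  have [x Tx defy] := g_surj Ty.
  (* replacing x by this component keeps z - diff x homogeneous *)
  pose x' := bipart pi (i - 1) q x.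
  have Tx' : x' \in Defs.total Q.
    exact: subvP (sub_bipiece_total _ _ _) _ (bipart_bipiece gr _ _ Tx).
  have defdx : diff Q eps x' = bipart pi i q (diff Q eps x).
    by rewrite /x' -(bipart_diff eps gr) // subrK.
  have Tdx := diff_total eps gr Tx; have Tdx' := diff_total eps gr Tx'.
  have [||w Tw defw] := @g_ker (z - diff Q eps x'); first exact: memvB.
    rewrite linearB /= defdx -[z in g z](bipart_id gr Pz) !g_bipart //.
    by rewrite gz defy g_chain // subrr.
  have Pzx : f w \in bipiece Q i q.
    by rewrite -defw memvB // defdx (bipart_bipiece gr).
  have Pw : bipart pi1 (i - 1 / 2) (q - 1 / 2) w = w.
    apply: f_inj => //; last by rewrite f_bipart // !halves (bipart_id gr).
    exact: subvP (sub_bipiece_total _ _ _) _ (bipart_bipiece gr1 _ _ Tw).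
  have dw : diff Q1 eps1 w = 0.
    apply: f_inj; rewrite ?mem0v ?(diff_total eps1 gr1) // linear0 f_chain //.
    by rewrite -defw linearB /= dz diff_diff // subrr.
  have Zw : w \in cycles Q1 eps1 by apply/cyclesP.
  apply/memv_imgP; exists (hclass Q1 eps1 w).
    by apply/HKhP; exists w; split=> //; rewrite -Pw (bipart_bipiece gr1).
  by rewrite alphaE // -defw linearB /= (hclass_diff gr) // subr0.
- move=> h /memv_imgP[h1 /HKhP[z [Pz dz defh1]] ->]; rewrite {h1}defh1.
  have Zz := bip_cycle _ _ _ _ _ _ Pz dz; have [Tz _] := cyclesP _ _ Zz.
  have Zgz := g_cycle Zz.
  rewrite betaE // memv_cap memv_ker gammaE //; apply/andP; split; last first.
    apply/HKhP; exists (g z); split=> //; last by rewrite -g_chain // dz linear0.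
    by rewrite -(bipart_id gr Pz) g_bipart // (bipart_bipiece gr2) // g_total.
  have [Tcz [t Tt [gt dt]]] := c_lift Zgz.
  have [||w Tw defw] := @g_ker (t - z); first exact: memvB.
    by rewrite linearB /= gt subrr.
  rewrite -(@f_inj (diff Q1 eps1 w) (c (g z))) ?(diff_total eps1 gr1) //.
    by rewrite (hclass_diff gr1).
  by rewrite f_chain // -defw linearB /= dz subr0.
- move=> h /memv_capP[kerh /HKhP[z [Pz dz defh]]]; move: kerh; rewrite {h}defh.
  have Zz := bip_cycle _ _ _ _ _ _ Pz dz; have [Tz _] := cyclesP _ _ Zz.
  rewrite memv_ker gammaE // => /eqP.
  move/(hclass_eq0P gr1 ok1 (c_cycle Zz))=> [w Tw defw].
  have [Tcz [t Tt [gt dt]]] := c_lift Zz.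
  pose u := t - f w; have Tu : u \in Defs.total Q by rewrite memvB ?f_total.
  have du : diff Q eps u = 0.
    by rewrite linearB /= dt defw f_chain // subrr.
  have gu : g u = z by rewrite linearB /= gf0 // subr0.
  pose u' := bipart pi i q u; have Pu' : u' \in bipiece Q i q.
    exact: (bipart_bipiece gr).
  have du' : diff Q eps u' = 0.
    rewrite -(bipart_diff eps gr) // du.
    by apply/ffunP=> S; rewrite ffunE cochain0 linear0 if_same.
  have gu' : g u' = z by rewrite g_bipart // gu (bipart_id gr2).
  apply/memv_imgP; exists (hclass Q eps u'); first by apply/HKhP; exists u'.
  by rewrite betaE ?gu' //; exact: (bip_cycle _ _ _ _ _ _ Pu' du').
- move=> h /memv_imgP[h1 /HKhP[z [Pz dz defh1]] ->]; rewrite {h1}defh1.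
  have Zz := bip_cycle _ _ _ _ _ _ Pz dz; have [Tz _] := cyclesP _ _ Zz.
  have [Tcz [t Tt [gt dt]]] := c_lift Zz; have Zcz := c_cycle Zz.
  rewrite gammaE // memv_cap memv_ker alphaE // -dt (hclass_diff gr) // eqxx /=.
  (* c z need not be homogeneous on the nose, but its class is: the lift t can
     be replaced by its homogeneous component *)
  pose t' := bipart pi i q t; have Pt' : t' \in bipiece Q i q.
    exact: (bipart_bipiece gr).
  have Tt' := subvP (sub_bipiece_total _ _ _) _ Pt'.
  have gt' : g t' = z by rewrite g_bipart // gt (bipart_id gr2).
  pose y := bipart pi1 (i + 1 / 2) (q - 1 / 2) (c z).
  have Py : y \in bipiece Q1 (i + 1 / 2) (q - 1 / 2).
    exact: (bipart_bipiece gr1).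
  have Ty := subvP (sub_bipiece_total _ _ _) _ Py.
  have fy : f y = diff Q eps t'.
    rewrite f_bipart // halves -dt -addrA.
    have -> : 1 / 2 + 1 / 2 = 1 :> rat by [].
    exact: (bipart_diff eps gr).
  have dy : diff Q1 eps1 y = 0.
    apply: f_inj; rewrite ?mem0v ?(diff_total eps1 gr1) // linear0 f_chain //.
    by rewrite fy diff_diff.
  have [||w Tw defw] := @g_ker (t - t'); first exact: memvB.
    by rewrite linearB /= gt gt' subrr.
  apply/HKhP; exists y; split=> //.
  apply/eqP; rewrite -subr_eq0 -linearB /=.
  rewrite -(@f_inj (diff Q1 eps1 w) (c z - y)) ?(diff_total eps1 gr1) ?memvB //.
    by rewrite (hclass_diff gr1).
  by rewrite f_chain // -defw !linearB /= fy dt.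
- move=> h /memv_capP[kerh /HKhP[y [Py dy defh]]]; move: kerh; rewrite {h}defh.
  have Zy := bip_cycle _ _ _ _ _ _ Py dy; have [Ty _] := cyclesP _ _ Zy.
  rewrite memv_ker alphaE // => /eqP.
  move/(hclass_eq0P gr ok (f_cycle Zy))=> [x Tx fy].
  pose x' := bipart pi i q x; have Px' : x' \in bipiece Q i q.
    exact: (bipart_bipiece gr).
  have Tx' := subvP (sub_bipiece_total _ _ _) _ Px'.
  have dx' : diff Q eps x' = f y.
    rewrite -(bipart_diff eps gr) // -fy -[in RHS](bipart_id gr1 Py) f_bipart //.
    rewrite halves -addrA; congr (bipart _ (_ + _) _ _).
  have Pgx : g x' \in bipiece Q2 (i + 1 / 2) (q + 1 / 2).
    by rewrite g_bipart // (bipart_bipiece gr2) // g_total.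
  have dgx : diff Q2 eps2 (g x') = 0 by rewrite -g_chain // dx' gf0.
  have Zgx := bip_cycle _ _ _ _ _ _ Pgx dgx.
  apply/memv_imgP; exists (hclass Q2 eps2 (g x')).
    by apply/HKhP; exists (g x').
  rewrite gammaE //; have [Tcz [t Tt [gt dt]]] := c_lift Zgx.
  have [||w Tw defw] := @g_ker (x' - t); first exact: memvB.
    by rewrite linearB /= gt subrr.
  apply/eqP; rewrite -subr_eq0 -linearB /=.
  rewrite -(@f_inj (diff Q1 eps1 w) (y - c (g x'))) ?(diff_total eps1 gr1)
    ?memvB //.
    by rewrite (hclass_diff gr1).
  by rewrite f_chain // -defw !linearB /= dx' dt.
Qed.

End LongExact.

(** * Facets of a cube *)

Section FacetSet.
Variables (n : nat) (l : 'I_n.+1).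
Implicit Types (S : {set 'I_n}) (b : bool).

Lemma mem_facet_set b S i :
  (i \in facet_set l b S) = if unlift l i is Some j then j \in S else b.
Proof.
have liftS : (i \in lift l @: S) = if unlift l i is Some j then j \in S else false.
  case: unliftP => [j ->|->]; first by rewrite mem_imset //; apply: lift_inj.
  by apply/imsetP => -[j _ /eqP]; rewrite (negPf (neq_lift _ _)).
rewrite /facet_set; case: b; rewrite ?inE liftS //; case: unliftP => [j ->|->].
  by rewrite eq_sym (negPf (neq_lift _ _)).
by rewrite eqxx.
Qed.

Lemma lift_facet_set b S j : (lift l j \in facet_set l b S) = (j \in S).
Proof. by rewrite mem_facet_set liftK. Qed.

Lemma self_facet_set b S : (l \in facet_set l b S) = b.
Proof. by rewrite mem_facet_set unlift_none. Qed.

Lemma eq_facet_set b S (X : {set 'I_n.+1}) :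
  (l \in X) = b -> (forall j, (lift l j \in X) = (j \in S)) ->
  X = facet_set l b S.
Proof.
move=> Xl XS; apply/setP=> i; rewrite mem_facet_set.
by case: unliftP => [j ->|->].
Qed.

Lemma facet_setU1 b S r : facet_set l b (r |: S) = lift l r |: facet_set l b S.
Proof.
symmetry; apply: eq_facet_set => [|j].
  by rewrite in_setU1 self_facet_set (negPf (neq_lift _ _)).
by rewrite !in_setU1 lift_facet_set (inj_eq lift_inj).
Qed.

Lemma facet_setD1 b S r : facet_set l b (S :\ r) = facet_set l b S :\ lift l r.
Proof.
symmetry; apply: eq_facet_set => [|j].
  by rewrite in_setD1 self_facet_set neq_lift.
by rewrite !in_setD1 lift_facet_set (inj_eq lift_inj).
Qed.

Lemma facet_set_true S : facet_set l true S = l |: facet_set l false S.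
Proof. by []. Qed.

Lemma facet_setK b : cancel (facet_set l b) (fun X => lift l @^-1: X).
Proof. by move=> S; apply/setP=> j; rewrite inE lift_facet_set. Qed.

Lemma facet_set_preim (X : {set 'I_n.+1}) :
  facet_set l (l \in X) (lift l @^-1: X) = X.
Proof. by symmetry; apply: eq_facet_set => // j; rewrite inE. Qed.

Lemma facet_set_trueD S : facet_set l true S :\ l = facet_set l false S.
Proof.
apply: eq_facet_set => [|j]; first by rewrite !inE eqxx.
by rewrite in_setD1 lift_facet_set eq_sym neq_lift.
Qed.

Lemma card_facet_set b S : #|facet_set l b S| = (b + #|S|)%N.
Proof.
have cardL : #|lift l @: S| = #|S| by apply: card_imset; apply: lift_inj.
case: b; last by [].
by rewrite facet_set_true cardsU1 self_facet_set /= cardL.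
Qed.

Lemma big_facet_set (W : nmodType) b S (F : 'I_n.+1 -> W) :
  \sum_(r in facet_set l b S) F r =
  (if b then F l else 0) + \sum_(r in S) F (lift l r).
Proof.
rewrite big_mkcond (bigD1_ord l) //= self_facet_set; congr (_ + _).
by rewrite [RHS]big_mkcond; apply: eq_bigr => r _; rewrite lift_facet_set.
Qed.

Lemma hdeg_facet_set b S : hdeg (facet_set l b S) = hdeg S + (b%:R - 1 / 2).
Proof.
by rewrite /hdeg card_facet_set natrD -[n.+1%:R]natr1; ring.
Qed.

End FacetSet.

(** An embedding F of the vertices of Q' onto those of a facet of Q, compatible
    with gradings and edges.  The map F S may vary with the vertex. *)
Definition facet_iso (K : fieldType) (n : nat) (Q : cube K n.+1) (l : 'I_n.+1)
    (b : bool) (Q' : cube K n) (F : {set 'I_n} -> 'Hom(amb Q', amb Q)) : Prop :=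
  forall S,
  [/\ lker (F S) == 0%VS, topdeg Q' S = topdeg Q (facet_set l b S),
      forall k, (F S @: piece Q' S k)%VS = piece Q (facet_set l b S) k &
      forall r, r \notin S -> {in vertex Q' S, forall t,
        F (r |: S) (edge Q' S r t) =
        edge Q (facet_set l b S) (lift l r) (F S t)}].

Lemma facet_iso_id (K : fieldType) (n : nat) (Q : cube K n.+1) (l : 'I_n.+1)
    (b : bool) : facet_iso l b (fun _ => facet_ident Q l b).
Proof.
move=> S; split=> [|//|k|r _ t _]; last by rewrite /facet_ident !lfunE.
  by apply/lker0P => u v; rewrite /facet_ident !lfunE.
exact: lim1g.
Qed.

Section Facet.
Variables (K : fieldType) (n : nat) (Q : cube K n.+1) (l : 'I_n.+1) (b : bool).
Variables (Q' : cube K n) (F : {set 'I_n} -> 'Hom(amb Q', amb Q)).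
Hypothesis F_iso : facet_iso l b F.
Implicit Type S : {set 'I_n}.

Let F_ker S : lker (F S) == 0%VS. Proof. by case: (F_iso S). Qed.
Let F_inj S : injective (F S). Proof. exact/lker0P. Qed.
Let F_edge S r t : r \notin S -> t \in vertex Q' S ->
  F (r |: S) (edge Q' S r t) = edge Q (facet_set l b S) (lift l r) (F S t).
Proof. by case: (F_iso S) => _ _ _ F_edge Sr; apply: F_edge. Qed.

Lemma limg_facet_vertex S :
  (F S @: vertex Q' S)%VS = vertex Q (facet_set l b S).
Proof.
by case: (F_iso S) => _ eq_top eq_piece _; rewrite /vertex eq_top limg_sum;
   apply: eq_bigr => k _.
Qed.

Lemma facet_vertex S t :
  (F S t \in vertex Q (facet_set l b S)) = (t \in vertex Q' S).
Proof. by rewrite -limg_facet_vertex !memvE -limg_line limg_ker0. Qed.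

Lemma facet_vertexP S u :
  u \in vertex Q (facet_set l b S) -> exists2 t, t \in vertex Q' S & u = F S t.
Proof. by rewrite -limg_facet_vertex => /memv_imgP. Qed.

Let shift : rat := b%:R - 1 / 2.

Lemma limg_facet_qpiece S q :
  (F S @: qpiece Q' S q)%VS = qpiece Q (facet_set l b S) (q + shift).
Proof.
case: (F_iso S) => _ eq_top eq_piece _; rewrite /qpiece limg_sum.
have eq_q k : (qdeg Q (facet_set l b S) k == q + shift) = (qdeg Q' S k == q).
  rewrite -[RHS](inj_eq (addIr shift)); congr (_ == _).
  by rewrite /qdeg eq_top card_facet_set natrD -[n.+1%:R]natr1 /shift; ring.
by rewrite eq_top; apply: eq_big => // k _; rewrite eq_piece.
Qed.

Lemma facet_qpiece S q t :
  (F S t \in qpiece Q (facet_set l b S) (q + shift)) = (t \in qpiece Q' S q).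
Proof. by rewrite -limg_facet_qpiece !memvE -limg_line limg_ker0. Qed.

Definition facet_pi (pi : {set 'I_n.+1} -> rat -> 'End(amb Q)) S q :
    'End(amb Q') :=
  ((F S)^-1 \o pi (facet_set l b S) (q + shift) \o F S)%VF.

Section Grading.
Variable pi : {set 'I_n.+1} -> rat -> 'End(amb Q).
Hypothesis pi_gr : qgrading pi.

Lemma facet_piE S q t : t \in vertex Q' S ->
  F S (facet_pi pi S q t) = pi (facet_set l b S) (q + shift) (F S t).
Proof.
rewrite -facet_vertex => /pi_gr[/(_ (q + shift)) + _ _].
rewrite -limg_facet_qpiece => /memv_imgP[u _ defu].
by rewrite /facet_pi !comp_lfunE defu lker0_lfunK.
Qed.

Lemma facet_qgrading : qgrading (facet_pi pi).
Proof.
move=> S t St; have FSt := St; rewrite -facet_vertex in FSt.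
have [pi_in pi_id pi_edge] := pi_gr FSt; split=> [q | q qt | r Sr].
- by rewrite -facet_qpiece facet_piE.
- by apply: (F_inj (S := S)); rewrite facet_piE // pi_id // facet_qpiece.
have lSr : lift l r \notin facet_set l b S by rewrite lift_facet_set.
have [Ve pi_e] := pi_edge _ lSr.
have Vet : edge Q' S r t \in vertex Q' (r |: S).
  by rewrite -facet_vertex F_edge // facet_setU1.
split=> // q; apply: (F_inj (S := r |: S)).
rewrite facet_piE // F_edge // facet_setU1 pi_e -facet_piE // -F_edge //.
by apply: (subvP (sub_qpiece_vertex _ _ q)); rewrite -facet_qpiece facet_piE.
Qed.

End Grading.

Variable eps : scalars K n.+1.
Hypothesis eps_ok : anticommuting Q eps.
Hypothesis edge_in : forall S r t, r \notin S -> t \in vertex Q' S ->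
  edge Q' S r t \in vertex Q' (r |: S).

(** Rescaling F S by kappa S changes the scalars of the facet by a coboundary,
    which does not affect anticommutation. *)
Definition facet_eps (kappa : {set 'I_n} -> K) : scalars K n := fun S r =>
  eps (facet_set l b S) (lift l r) * kappa S / kappa (r |: S).

Variable kappa : {set 'I_n} -> K.
Hypothesis kappa_neq0 : forall S, kappa S != 0.

Lemma facet_edge_scaled S r t : r \notin S -> t \in vertex Q' S ->
  kappa (r |: S) *: F (r |: S) (facet_eps kappa S r *: edge Q' S r t) =
  eps (facet_set l b S) (lift l r) *:
    edge Q (facet_set l b S) (lift l r) (kappa S *: F S t).
Proof.
move=> Sr St; rewrite !linearZ /= F_edge // !scalerA; congr (_ *: _).
by rewrite /facet_eps divfK // mulrC.
Qed.

Lemma facet_anticommuting : anticommuting Q' (facet_eps kappa).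
Proof.
have [eps_neq0 sq0] := eps_ok; split=> [S r Sr | S r s Sr Ss neq_rs t St].
  by rewrite /facet_eps !mulf_neq0 ?invr_eq0 ?kappa_neq0 ?eps_neq0 ?lift_facet_set.
have step x y : x \notin S -> y \notin S -> x != y ->
    kappa (y |: (x |: S)) *: F (y |: (x |: S)) (facet_eps kappa (x |: S) y *:
      edge Q' (x |: S) y (facet_eps kappa S x *: edge Q' S x t)) =
    kappa S *: (eps (lift l x |: facet_set l b S) (lift l y) *:
      edge Q (lift l x |: facet_set l b S) (lift l y)
        (eps (facet_set l b S) (lift l x) *:
          edge Q (facet_set l b S) (lift l x) (F S t))).
  move=> Sx Sy neq_xy; rewrite facet_edge_scaled.
  - rewrite facet_edge_scaled // -facet_setU1 !linearZ /= !scalerA.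
    by congr (_ *: _); ring.
  - by rewrite !inE eq_sym negb_or neq_xy.
  by rewrite memvZ ?edge_in.
have eqU : s |: (r |: S) = r |: (s |: S) by rewrite setUCA.
apply: (F_inj (S := s |: (r |: S))); apply: (scalerI (kappa_neq0 (s |: (r |: S)))).
rewrite linearD /= scalerDr step // eqU step //; last by rewrite eq_sym.
rewrite -scalerDr sq0 ?lift_facet_set ?(inj_eq lift_inj) ?facet_vertex //.
by rewrite !linear0.
Qed.

Lemma facet_diff (t : cochain Q') (u : cochain Q) S :
  t \in Defs.total Q' ->
  (forall S', u (facet_set l b S') = kappa S' *: F S' (t S')) ->
  \sum_(r in S) eps (facet_set l b S :\ lift l r) (lift l r) *:
    edge Q (facet_set l b S :\ lift l r) (lift l r)
      (u (facet_set l b S :\ lift l r)) =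
  kappa S *: F S (diff Q' (facet_eps kappa) t S).
Proof.
move=> /totalP Tt defu; rewrite diffE linear_sum scaler_sumr /=.
apply: eq_bigr => r Sr; have nSr : r \notin S :\ r by rewrite !inE eqxx.
by rewrite -facet_setD1 defu -facet_edge_scaled // setD1K.
Qed.

End Facet.

Section FacetSequence.
Variables (K : fieldType) (n : nat) (Q : cube K n.+1) (l : 'I_n.+1).
Variables (eps : scalars K n.+1) (pi : {set 'I_n.+1} -> rat -> 'End(amb Q)).
Hypotheses (eps_ok : anticommuting Q eps) (pi_gr : qgrading pi).
Implicit Type S : {set 'I_n}.

Section InOut.
Variables (b : bool) (Q' : cube K n) (F : {set 'I_n} -> 'Hom(amb Q', amb Q)).
Variable kappa : {set 'I_n} -> K.

Definition facet_in_fun (t : cochain Q') : cochain Q :=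
  [ffun X : {set 'I_n.+1} => if (l \in X) == b
     then kappa (lift l @^-1: X) *: F (lift l @^-1: X) (t (lift l @^-1: X))
     else 0].

Fact facet_in_linear : linear facet_in_fun.
Proof.
move=> a t u; apply/ffunP=> X; rewrite !ffunE.
case: ifP => _; last by rewrite scaler0 addr0.
by rewrite linearP scalerDr !scalerA mulrC.
Qed.

HB.instance Definition _ :=
  GRing.isLinear.Build K (cochain Q') (cochain Q) _ facet_in_fun facet_in_linear.

Definition facet_in : 'Hom(cochain Q', cochain Q) := linfun facet_in_fun.

Lemma facet_inE t b' S : facet_in t (facet_set l b' S) =
  if b' == b then kappa S *: F S (t S) else 0.
Proof. by rewrite lfunE /= ffunE self_facet_set facet_setK. Qed.

Definition facet_out_fun (z : cochain Q) : cochain Q' :=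
  [ffun S : {set 'I_n} => (F S)^-1%VF (z (facet_set l b S))].

Fact facet_out_linear : linear facet_out_fun.
Proof. by move=> a t u; apply/ffunP=> X; rewrite !ffunE linearP. Qed.

HB.instance Definition _ :=
  GRing.isLinear.Build K (cochain Q) (cochain Q') _ facet_out_fun facet_out_linear.

Definition facet_out : 'Hom(cochain Q, cochain Q') := linfun facet_out_fun.

Lemma facet_outE z S : facet_out z S = (F S)^-1%VF (z (facet_set l b S)).
Proof. by rewrite lfunE /= ffunE. Qed.

End InOut.

Lemma facet_setP (P : {set 'I_n.+1} -> Prop) :
  (forall b S, P (facet_set l b S)) -> forall X, P X.
Proof. by move=> PF X; rewrite -(facet_set_preim l X). Qed.

Variables (Q1 Q2 : cube K n).
Variables (F1 : {set 'I_n} -> 'Hom(amb Q1, amb Q)).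
Variables (F2 : {set 'I_n} -> 'Hom(amb Q2, amb Q)).
Hypotheses (F1_iso : facet_iso l true F1) (F2_iso : facet_iso l false F2).
Variables (lambda : {set 'I_n} -> K) (c : {linear cochain Q2 -> cochain Q1}).
Hypothesis lambda_neq0 : forall S, lambda S != 0.
Hypothesis c_edge : forall z S, z \in Defs.total Q2 -> c z S \in vertex Q1 S /\
  F1 S (c z S) = lambda S *: edge Q (facet_set l false S) l (F2 S (z S)).

(** The scaling for which F1 turns c into the part of the differential of Q
    that crosses from one facet to the other. *)
Definition cross_scaling S := eps (facet_set l false S) l / lambda S.

Let kappa_neq0 S : cross_scaling S != 0.
Proof.
by rewrite mulf_neq0 ?invr_eq0 ?lambda_neq0 // (proj1 eps_ok) ?self_facet_set.
Qed.

Let one_neq0 S : (fun _ => 1 : K) S != 0. Proof. exact: oner_neq0. Qed.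

Let eps1 := facet_eps l true eps cross_scaling.
Let eps2 := facet_eps l false eps (fun _ => 1).
Let gr1 := facet_qgrading F1_iso pi_gr.
Let gr2 := facet_qgrading F2_iso pi_gr.

Lemma sub_facet_anticommuting : anticommuting Q1 eps1.
Proof. exact: (facet_anticommuting F1_iso eps_ok (edge_vertex gr1)). Qed.

Lemma quot_facet_anticommuting : anticommuting Q2 eps2.
Proof. exact: (facet_anticommuting F2_iso eps_ok (edge_vertex gr2)). Qed.

Let f := facet_in true F1 cross_scaling.
Let g := facet_out false F2.

Let F1_ker S : lker (F1 S) == 0%VS. Proof. by case: (F1_iso S). Qed.
Let F2_ker S : lker (F2 S) == 0%VS. Proof. by case: (F2_iso S). Qed.

Let F1_inj S : injective (F1 S). Proof. exact/lker0P. Qed.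
Let F2_inj S : injective (F2 S). Proof. exact/lker0P. Qed.

Let f_true t S : f t (facet_set l true S) = cross_scaling S *: F1 S (t S).
Proof. by rewrite facet_inE. Qed.

Let f_false t S : f t (facet_set l false S) = 0.
Proof. by rewrite facet_inE. Qed.

Let f_total t : t \in Defs.total Q1 -> f t \in Defs.total Q.
Proof.
move/totalP=> Tt; apply/totalP; apply: facet_setP => -[] S.
  by rewrite f_true memvZ // (facet_vertex F1_iso).
by rewrite f_false mem0v.
Qed.

Let f_chain : chain_map eps1 eps f.
Proof.
move=> t Tt; apply/ffunP; apply: facet_setP => -[] S; last first.
  rewrite f_false [diff Q eps _ _]diffE big_facet_set add0r big1 // => r _.
  by rewrite -facet_setD1 f_false linear0 scaler0.
rewrite f_true [diff Q eps _ _]diffE big_facet_set facet_set_trueD f_false.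
by rewrite linear0 scaler0 add0r (facet_diff F1_iso eps kappa_neq0 S Tt).
Qed.

(** The section of g supported on the facet that avoids l. *)
Let s := facet_in false F2 (fun _ => 1).

Let s_true t S : s t (facet_set l true S) = 0.
Proof. by rewrite facet_inE. Qed.

Let s_false t S : s t (facet_set l false S) = F2 S (t S).
Proof. by rewrite facet_inE /= scale1r. Qed.

Let gs t : g (s t) = t.
Proof. by apply/ffunP=> S; rewrite facet_outE s_false lker0_lfunK. Qed.

Let s_total t : t \in Defs.total Q2 -> s t \in Defs.total Q.
Proof.
move/totalP=> Tt; apply/totalP; apply: facet_setP => -[] S.
  by rewrite s_true mem0v.
by rewrite s_false (facet_vertex F2_iso).
Qed.

Let F2_g t S : t \in Defs.total Q -> F2 S (g t S) = t (facet_set l false S).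
Proof.
move/totalP/(_ (facet_set l false S))/(facet_vertexP F2_iso)=> [u _ def_t].
by rewrite facet_outE def_t lker0_lfunK.
Qed.

Let g_total t : t \in Defs.total Q -> g t \in Defs.total Q2.
Proof.
move=> Tt; apply/totalP=> S; rewrite -(facet_vertex F2_iso) F2_g //.
exact: totalP.
Qed.

Let g_chain : chain_map eps eps2 g.
Proof.
move=> t Tt; apply/ffunP=> S; rewrite facet_outE [diff Q eps t _]diffE.
rewrite big_facet_set add0r.
rewrite (@facet_diff _ _ _ _ _ _ _ F2_iso eps _ one_neq0 (g t)) ?g_total //.
  by rewrite scale1r lker0_lfunK.
by move=> S'; rewrite scale1r F2_g.
Qed.

Let fg_exact : short_exact f g.
Proof.
split.
- apply/eqP; rewrite -subv0; apply/subvP=> t /memv_capP[].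
  rewrite memv_ker memv0 => /eqP ft0 _; apply/eqP/ffunP=> S.
  apply: (@F1_inj S); apply: (scalerI (kappa_neq0 S)).
  by rewrite -f_true ft0 !cochain0 !linear0.
- apply/eqP; rewrite eqEsubv; apply/andP; split; apply/subvP=> t.
    case/memv_imgP=> u Tu ->; rewrite memv_cap f_total // memv_ker andbT.
    by apply/eqP/ffunP=> S; rewrite facet_outE f_false linear0 cochain0.
  rewrite memv_cap memv_ker => /andP[/eqP gt0 Tt].
  pose u : cochain Q1 := [ffun S => (cross_scaling S)^-1 *:
                                    (F1 S)^-1%VF (t (facet_set l true S))].
  have F1u S : cross_scaling S *: F1 S (u S) = t (facet_set l true S).
    rewrite ffunE linearZ /= scalerA divff // scale1r.
    have := totalP t Tt (facet_set l true S).
    by case/(facet_vertexP F1_iso) => v _ ->; rewrite lker0_lfunK.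
  apply/memv_imgP; exists u.
    apply/totalP=> S; rewrite -(facet_vertex F1_iso).
    rewrite -[F1 S _](scalerK (kappa_neq0 S)) F1u memvZ //.
    exact: totalP.
  apply/ffunP; apply: facet_setP => -[] S; first by rewrite f_true F1u.
  by rewrite f_false -F2_g // gt0 cochain0 linear0.
- apply/eqP; rewrite eqEsubv; apply/andP; split; apply/subvP=> t.
    by case/memv_imgP=> u Tu ->; apply: g_total.
  by move=> Tt; rewrite -(gs t) memv_img // s_total.
Qed.

Let f_bipart j q : {in Defs.total Q1, forall t,
  f (bipart (facet_pi l true F1 pi) j q t) =
  bipart pi (j + 1 / 2) (q + 1 / 2) (f t)}.
Proof.
move=> t /totalP Tt; apply/ffunP; apply: facet_setP => -[] S.
  rewrite f_true !ffunE hdeg_facet_set (inj_eq (addIr _)); case: ifP => _.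
    by rewrite (facet_piE F1_iso pi_gr) // f_true linearZ.
  by rewrite linear0 scaler0.
by rewrite f_false ffunE f_false linear0 if_same.
Qed.

Let g_bipart j q : {in Defs.total Q, forall t,
  g (bipart pi j q t) =
  bipart (facet_pi l false F2 pi) (j + 1 / 2) (q + 1 / 2) (g t)}.
Proof.
have halfK (x : rat) : x = x + 1 / 2 + (0 - 1 / 2) by rewrite sub0r addrK.
move=> t Tt; apply/ffunP=> S; rewrite facet_outE !ffunE hdeg_facet_set.
rewrite {1}[j]halfK (inj_eq (addIr _)); case: ifP => _; last by rewrite linear0.
apply: (@F2_inj S); rewrite (facet_piE F2_iso pi_gr); last first.
  exact: totalP (g_total Tt) S.
rewrite F2_g // -halfK; have := totalP t Tt (facet_set l false S).
case/pi_gr => /(_ q)/(subvP (sub_qpiece_vertex _ _ _)) + _ _.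
by case/(facet_vertexP F2_iso) => u _ ->; rewrite lker0_lfunK.
Qed.

Let c_lift : {in cycles Q2 eps2, forall z, c z \in Defs.total Q1 /\
  exists2 t, t \in Defs.total Q & g t = z /\ diff Q eps t = f (c z)}.
Proof.
move=> z /cyclesP[Tz dz]; split.
  by apply/totalP=> S; case: (c_edge S Tz).
exists (s z); first exact: s_total.
split; first exact: gs.
apply/ffunP; apply: facet_setP => -[] S;
  rewrite [diff Q eps _ _]diffE big_facet_set.
  rewrite f_true facet_set_trueD s_false (proj2 (c_edge S Tz)) scalerA divfK //.
  rewrite big1 ?addr0 // => r _.
  by rewrite -facet_setD1 s_true linear0 scaler0.
rewrite add0r f_false.
rewrite (@facet_diff _ _ _ _ _ _ _ F2_iso eps _ one_neq0 z) //.
  by rewrite dz cochain0 !linear0.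
by move=> S'; rewrite scale1r s_false.
Qed.

Theorem facet_long_exact : long_exact Q1 eps1 Q eps Q2 eps2 c.
Proof.
exact: (long_exact_snake gr1 pi_gr gr2 sub_facet_anticommuting eps_ok
  quot_facet_anticommuting f_chain g_chain fg_exact f_bipart g_bipart c_lift).
Qed.

End FacetSequence.

(** * Exterior powers and their functoriality *)

Section ExteriorTheory.
Variables (K : fieldType) (V : vectType K).
Local Notation d := (\dim {:V}).
Local Notation b := (tnth (vbasis {:V})).
Implicit Types (u v : V) (x y : ext V) (B : {set 'I_d}) (H : {vspace V}).

Lemma coord_vbasisf v : v = \sum_i coord (vbasis {:V}) i v *: b i.
Proof.
rewrite {1}(coord_vbasis (memvf v)).
by apply: eq_bigr => i _; rewrite -tnth_nth.
Qed.

Lemma coord_b i j : coord (vbasis {:V}) i (b j) = (i == j)%:R.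
Proof.
have b_free : free (vbasis {:V}) := basis_free (vbasisP _).
by rewrite (tnth_nth 0) (coord_free _ _ b_free) eq_sym.
Qed.

Lemma ext_sum x : x = \sum_B x B *: ebase B.
Proof.
apply/ffunP=> C; rewrite sum_ffunE (bigD1 C) //= big1 ?addr0 => [|B neqB].
  by rewrite !ffunE eqxx [RHS]mulr1.
by rewrite !ffunE eq_sym (negPf neqB) [LHS]mulr0.
Qed.

Fact lwedge_is_linear : linear (@lwedge K V).
Proof.
move=> a u v; apply/lfunP=> x; rewrite add_lfunE scale_lfunE !lwedgeE.
apply/ffunP=> B; rewrite !ffunE [X in _ = X + _]mulr_sumr -big_split.
by apply: eq_bigr => i _; rewrite linearP /= !mulrDl !mulrA.
Qed.

HB.instance Definition _ :=
  GRing.isLinear.Build K V 'End(ext V) _ (@lwedge K V) lwedge_is_linear.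

Lemma lwedge_sum v :
  lwedge v = \sum_i coord (vbasis {:V}) i v *: lwedge (b i).
Proof.
rewrite {1}(coord_vbasisf v) linear_sum; apply: eq_bigr => i _.
by rewrite linearZ.
Qed.

Lemma lwedge_basis i B : lwedge (b i) (ebase B) =
  if i \in B then 0 else (-1) ^+ #|[set a in B | (a < i)%N]| *: ebase (i |: B).
Proof.
rewrite lwedgeE; apply/ffunP=> C; rewrite ffunE.
have term k : k != i -> coord (vbasis {:V}) k (b i) *
    (-1) ^+ #|[set a in C | (a < k)%N]| * ebase B (C :\ k) = 0.
  by move=> neq_ki; rewrite coord_b (negPf neq_ki) !mul0r.
case: (boolP (i \in C)) => Ci; last first.
  rewrite big1 => [|k Ck]; last first.
    by apply: term; apply: contraNneq Ci => <-.
  case: ifP => _; rewrite !ffunE // (negPf (contraNneq _ Ci)) ?[RHS]mulr0 //.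
  by move->; rewrite !inE eqxx.
rewrite (bigD1 i) //= big1 ?addr0 => [|k /andP[_ /term] //].
rewrite coord_b eqxx mul1r ffunE.
case: (eqVneq (C :\ i) B) => [defB | neqB].
  rewrite -defB !inE eqxx /= !ffunE setD1K // eqxx.
  congr (_ ^+ _ * _); apply: eq_card => a; rewrite !inE.
  by case: eqVneq => // ->; rewrite ltnn andbF.
rewrite mulr0; case: ifPn => Bi; rewrite !ffunE //.
rewrite (negPf (contra_neq _ neqB)) ?[RHS]mulr0 // => ->.
by rewrite setU1K.
Qed.

Lemma lwedge_basisC i j B : i != j ->
  lwedge (b i) (lwedge (b j) (ebase B)) = - lwedge (b j) (lwedge (b i) (ebase B)).
Proof.
move=> neq_ij; rewrite !lwedge_basis.
have ins k k' : k \notin B -> k != k' ->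
    #|[set a in k |: B | (a < k')%N]| = ((k < k') + #|[set a in B | (a < k')%N]|)%N.
  move=> Bk neq_k; case: ltnP => lt_k.
    rewrite (cardsD1 k) !inE eqxx lt_k /=; congr (_ + _)%N.
    apply: eq_card => a; rewrite !inE.
    by case: eqVneq => [->|]; rewrite ?(negPf Bk).
  apply: eq_card => a; rewrite !inE.
  by case: eqVneq => [->|//]; rewrite (negPf Bk) ltnNge lt_k.
case: ifPn => Bj; case: ifPn => Bi; rewrite ?linear0 ?oppr0 //.
- by rewrite linearZ /= lwedge_basis !inE Bj orbT scaler0 oppr0.
- by rewrite linearZ /= lwedge_basis !inE Bi orbT scaler0.
rewrite ![lwedge _ (_ *: _)]linearZ /= !lwedge_basis !inE.
rewrite (negPf Bi) (negPf Bj) !orbF.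
rewrite [j == i]eq_sym (negPf neq_ij) !scalerA -scaleNr.
rewrite (ins j i) ?(ins i j) // 1?eq_sym // setUCA; congr (_ *: _).
rewrite !exprD; case: (ltngtP i j) => [_|_|/ord_inj eq_ij].
- by rewrite /= expr0 expr1 mul1r !mulN1r mulrN opprK mulrC.
- by rewrite /= expr0 expr1 mul1r !mulN1r mulrN mulrC.
by rewrite eq_ij eqxx in neq_ij.
Qed.

Lemma lwedge_basis2 i B : lwedge (b i) (lwedge (b i) (ebase B)) = 0.
Proof.
rewrite lwedge_basis; case: ifP => _; first by rewrite linear0.
by rewrite linearZ /= lwedge_basis !inE eqxx scaler0.
Qed.

Lemma lwedge_sq v x : lwedge v (lwedge v x) = 0.
Proof.
rewrite (ext_sum x) !linear_sum big1 // => B _; rewrite !linearZ /=.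
suff ->: lwedge v (lwedge v (ebase B)) = 0 by rewrite scaler0.
pose a r s := (coord (vbasis {:V}) r v * coord (vbasis {:V}) s v) *:
  lwedge (b r) (lwedge (b s) (ebase B)).
transitivity (\sum_r \sum_(s | xpredT s && (s != r)) a r s); last first.
  apply: sum_antisym => r s _ _ neq_rs.
  by rewrite /a lwedge_basisC // scalerN [coord _ _ _ * _]mulrC addNr.
rewrite lwedge_sum sum_lfunE; apply: eq_bigr => r _.
rewrite scale_lfunE sum_lfunE linear_sum scaler_sumr [LHS](bigD1 r) //=.
rewrite scale_lfunE linearZ /= lwedge_basis2 !scaler0 add0r.
by apply: eq_bigr => s _; rewrite /a scale_lfunE linearZ /= scalerA.
Qed.

Lemma lwedgeC u v x : lwedge u (lwedge v x) = - lwedge v (lwedge u x).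
Proof.
apply/eqP; rewrite -addr_eq0; have := lwedge_sq (u + v) x.
by rewrite linearD /= !add_lfunE !linearD /= !lwedge_sq addr0 add0r => ->.
Qed.

Lemma lwedge_wedge_cat v (s1 s2 : seq V) :
  lwedge v (wedge (s1 ++ s2)) = (-1) ^+ size s1 *: wedge (s1 ++ v :: s2).
Proof.
elim: s1 => [|u s1 IHs] /=; first by rewrite scale1r.
by rewrite lwedgeC IHs linearZ /= exprS mulN1r scaleNr.
Qed.

Lemma wedge_nuniq (s : seq V) : ~~ uniq s -> wedge s = 0.
Proof.
elim: s => //= v s IHs; rewrite negb_and negbK => /orP[|/IHs->].
  case/splitPr=> s1 s2; have sgn_neq0 : (-1) ^+ size s1 != 0 :> K.
    by rewrite signr_eq0.
  apply: (scalerI sgn_neq0).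
  by rewrite scaler0 -linearZ /= -lwedge_wedge_cat lwedge_sq.
by rewrite linear0.
Qed.

Lemma enum_split i B : exists s1 s2 : seq 'I_d,
  (if i \in B then enum B = s1 ++ i :: s2 else enum B = s1 ++ s2) /\
  enum (i |: B) = s1 ++ i :: s2.
Proof.
have enumE (C : {set 'I_d}) : enum C = filter (mem C) (enum 'I_d).
  by rewrite enumT.
have := enum_uniq 'I_d; have := mem_enum 'I_d i; rewrite inE.
rewrite !enumE => /splitPr[s1 s2]; rewrite cat_uniq /= negb_or.
case/and3P=> _ /andP[s1i _] /andP[s2i _].
exists (filter (mem B) s1), (filter (mem B) s2).
have filt s : i \notin s -> filter (mem (i |: B)) s = filter (mem B) s.
  move=> si; apply: eq_in_filter => a sa; rewrite !inE.
  by case: eqVneq => // eq_ai; rewrite -eq_ai sa in si.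
rewrite !filter_cat /= !filt // !inE eqxx; split=> //.
by case: (i \in B).
Qed.

Lemma wedge_basis_enum B : wedge [seq b i | i <- enum B] = ebase B.
Proof.
have srt: pairwise ltn [seq val i | i <- enum B].
  rewrite -(sorted_pairwise ltn_trans).
  apply: (subseq_sorted ltn_trans (s2 := map val (enum 'I_d))).
    by apply: map_subseq; rewrite [enum 'I_d]enumT; apply: filter_subseq.
  by rewrite val_enum_ord iota_ltn_sorted.
have uB := enum_uniq B.
rewrite -{2}(set_enum B); elim: (enum B) srt uB => [|i s IHs] /=.
  by rewrite set_nil.
case/andP=> /allP lt_is srt /andP[si us].
rewrite IHs // lwedge_basis inE (negPf si) set_cons.
rewrite (_ : [set a in _ | _] = set0) ?cards0 ?scale1r //.
apply/setP=> a; rewrite !inE; apply/andP=> -[sa].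
by rewrite ltnNge ltnW //; apply: lt_is; apply: map_f.
Qed.

End ExteriorTheory.

Section ExteriorMap.
Variables (K : fieldType) (V V' : vectType K) (f : 'Hom(V, V')).
Implicit Types (v : V) (x : ext V).
Local Notation b := (tnth (vbasis {:V})).

Lemma extmap_ebase B :
  extmap f (ebase B) = wedge [seq f (b i) | i <- enum B].
Proof.
rewrite extmapE /= /extmap_fun (bigD1 B) //= big1 ?addr0 => [|C neqC].
  by rewrite ffunE eqxx scale1r.
by rewrite ffunE (negPf neqC) scale0r.
Qed.

(** Both sides are governed by the sign rule for moving a vector into place in
    an ordered wedge product. *)
Lemma extmap_lwedge v x : extmap f (lwedge v x) = lwedge (f v) (extmap f x).
Proof.
suff on_basis i B : extmap f (lwedge (b i) (ebase B)) =
    lwedge (f (b i)) (extmap f (ebase B)).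
  have on_vectors i : extmap f (lwedge (b i) x) = lwedge (f (b i)) (extmap f x).
    rewrite (ext_sum x) !linear_sum; apply: eq_bigr => B _.
    by rewrite !linearZ /= on_basis.
  rewrite [in RHS](coord_vbasisf v) lwedge_sum sum_lfunE !linear_sum sum_lfunE.
  apply: eq_bigr => i _.
  by rewrite scale_lfunE !linearZ /= scale_lfunE on_vectors.
rewrite !extmap_ebase -{1}wedge_basis_enum.
have [s1 [s2 [enB eniB]]] := enum_split i B; case: ifP enB => [Bi -> | _ ->].
  have rep0 (W : vectType K) (u : W) t1 t2 : lwedge u (wedge (t1 ++ u :: t2)) = 0.
    rewrite -[LHS]/(wedge (u :: t1 ++ u :: t2)) wedge_nuniq //=.
    by rewrite mem_cat mem_head orbT.
  by rewrite !map_cat /= !rep0 linear0.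
rewrite !map_cat !lwedge_wedge_cat !size_map linearZ /=; congr (_ *: _).
have -> : [seq b i0 | i0 <- s1] ++ b i :: [seq b i0 | i0 <- s2] =
          [seq b j | j <- enum (i |: B)] by rewrite eniB map_cat.
by rewrite wedge_basis_enum extmap_ebase eniB map_cat.
Qed.

Lemma extmap_wedge s : extmap f (wedge s) = wedge (map f s).
Proof.
elim: s => [|v s IHs] /=; last by rewrite extmap_lwedge IHs.
by rewrite extmap_ebase enum_set0.
Qed.

End ExteriorMap.

Section ExteriorFunctor.
Variables (K : fieldType).
Implicit Types V : vectType K.

Lemma extmap_comp V V' V'' (g : 'Hom(V', V'')) (f : 'Hom(V, V')) :
  extmap (g \o f) = (extmap g \o extmap f)%VF.
Proof.
apply/lfunP=> x; rewrite (ext_sum x) !linear_sum; apply: eq_bigr => B _.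
rewrite !linearZ /= -wedge_basis_enum comp_lfunE; congr (_ *: _).
rewrite !extmap_wedge -!map_comp; congr wedge.
by apply: eq_map => i; rewrite /= comp_lfunE.
Qed.

Lemma extmap_id V : extmap \1%VF = \1%VF :> 'End(ext V).
Proof.
apply/lfunP=> x; rewrite (ext_sum x) !linear_sum; apply: eq_bigr => B _.
rewrite !linearZ /= -wedge_basis_enum extmap_wedge; congr (_ *: _).
rewrite id_lfunE -map_comp; congr wedge.
by apply: eq_map => i; rewrite /= id_lfunE.
Qed.

Lemma extmap_ker0 V V' (f : 'Hom(V, V')) :
  lker f == 0%VS -> lker (extmap f) == 0%VS.
Proof.
move=> f_ker0; apply/lker0P; apply: (can_inj (g := extmap f^-1)) => x.
by rewrite -comp_lfunE -extmap_comp lker0_compVf // extmap_id id_lfunE.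
Qed.

End ExteriorFunctor.

Section ExteriorPower.
Variables (K : fieldType) (V : vectType K).
Implicit Types (v : V) (x : ext V) (H : {vspace V}) (s : seq V).
Local Notation d := (\dim {:V}).

Lemma extpowP H i (X : {vspace ext V}) :
  (forall s, size s = i -> {subset s <= H} -> wedge s \in X) ->
  (extpow H i <= X)%VS.
Proof.
move=> HX; apply/span_subvP=> _ /mapP[t _ ->]; apply: HX => [|v].
  by rewrite size_map size_tuple.
by case/mapP=> j _ ->; apply: vbasis_mem; apply: mem_tnth.
Qed.

Lemma lwedge_extpow H i v :
  v \in H -> (lwedge v @: extpow H i <= extpow H i.+1)%VS.
Proof.
move=> Hv; rewrite limg_span; apply/span_subvP=> _ /mapP[_ /mapP[t _ ->] ->].
rewrite (coord_vbasis Hv) linear_sum sum_lfunE; apply: memv_suml => k _.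
rewrite linearZ /= scale_lfunE; apply: memvZ; apply: memv_span.
apply/mapP; exists [tuple of k :: t]; first by rewrite mem_enum.
by rewrite /= (tnth_nth 0).
Qed.

Lemma wedge_extpow H s : {subset s <= H} -> wedge s \in extpow H (size s).
Proof.
elim: s => [_|v s IHs sH].
  apply: memv_span; apply/mapP; exists [tuple] => //; first by rewrite mem_enum.
have /subvP := lwedge_extpow (size s) (sH v (mem_head _ _)).
by apply; apply: memv_img; apply: IHs => u su; apply: sH; rewrite inE su orbT.
Qed.

Lemma extpowS H H' i : (H <= H')%VS -> (extpow H i <= extpow H' i)%VS.
Proof.
move=> /subvP sHH'; apply: extpowP => s <- sH; apply: wedge_extpow => v /sH.
exact: sHH'.
Qed.

Lemma extpow_gt_dim H i : (\dim H < i)%N -> extpow H i = 0%VS.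
Proof.
move=> lt_Hi; apply/eqP; rewrite -subv0; apply/span_subvP=> _ /mapP[t _ ->].
rewrite memv0; apply/eqP; apply: wedge_nuniq; apply: contraL lt_Hi.
move/map_uniq => ut; rewrite -leqNgt -(size_tuple t).
by rewrite -(card_uniqP ut); apply: leq_trans (max_card _) _; rewrite card_ord.
Qed.

Lemma wedge_coef0 s (B : {set 'I_d}) : #|B| != size s -> wedge s B = 0.
Proof.
elim: s B => [|v s IHs] B /=; first by rewrite ffunE cards_eq0 => /negPf->.
rewrite lwedgeE ffunE => neqB; rewrite big1 // => i Bi; rewrite IHs ?mulr0 //.
by apply: contraNneq neqB => <-; rewrite (cardsD1 i B) Bi.
Qed.

End ExteriorPower.

Section ExteriorPowerMap.
Variables (K : fieldType) (V V' : vectType K).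
Implicit Types (v : V) (x : ext V) (H : {vspace V}) (f g : 'Hom(V, V')).

Lemma eq_in_extmap H f g i :
  {in H, f =1 g} -> {in extpow H i, extmap f =1 extmap g}.
Proof.
move=> eq_fg; apply/eqlfun_inP; apply: extpowP => s _ sH; apply/eqlfunP.
rewrite !extmap_wedge; congr wedge.
by apply/eq_in_map => v sv; apply: eq_fg; apply: sH.
Qed.

Lemma limg_extmap f H i : (extmap f @: extpow H i)%VS = extpow (f @: H) i.
Proof.
apply/eqP; rewrite eqEsubv; apply/andP; split.
  rewrite limg_span; apply/span_subvP=> _ /mapP[_ /mapP[t _ ->] ->].
  rewrite extmap_wedge; set s := map f _.
  have <- : size s = i by rewrite !size_map size_tuple.
  apply: wedge_extpow => _ /mapP[_ /mapP[j _ ->] ->].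
  by rewrite memv_img // vbasis_mem // mem_tnth.
apply: extpowP => s <- sfH; pose h := (f \o projv H)%VF.
have hK (v : V') : v \in (f @: H)%VS -> f (projv H (h^-1%VF v)) = v.
  rewrite -{1}(limg_proj H) -limg_comp => hv.
  by have := limg_lfunVK hv; rewrite comp_lfunE.
have <- : map f (map (projv H \o h^-1%VF) s) = s.
  by rewrite -map_comp map_id_in // => v /sfH/hK.
rewrite -extmap_wedge size_map; apply: memv_img.
by apply: wedge_extpow => _ /mapP[v _ ->]; apply: memv_proj.
Qed.

(** Wedging with w only sees the other factors modulo w. *)
Lemma lwedge_extmap_mod (w : V') H f g i :
  {in H, forall v, f v - g v \in <[w]>%VS} ->
  {in extpow H i, forall x, lwedge w (extmap f x) = lwedge w (extmap g x)}.
Proof.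
move=> eq_fg x; rewrite -!(comp_lfunE (lwedge w)); move: x; apply/eqlfun_inP.
apply: extpowP => s _ sH; apply/eqlfunP; rewrite !comp_lfunE !extmap_wedge.
elim: s sH => //= v s IHs sH.
rewrite lwedgeC IHs; last by move=> u su; rewrite sH // inE su orbT.
rewrite -lwedgeC.
have /vlineP[c /(canRL (subrK _)) ->] := eq_fg v (sH v (mem_head _ _)).
rewrite linearD add_lfunE linearZ scale_lfunE linearD linearZ /= lwedge_sq.
by rewrite scaler0 add0r.
Qed.

End ExteriorPowerMap.

(** * Tensor products of exterior algebras *)

Section Tensor.
Variables (K : fieldType) (V W : vectType K).
Implicit Types (x : ext V) (y : ext W) (t : tens V W).

Fact tensor_linear x : linear (@tensor K V W x).
Proof.
move=> a u v; apply/ffunP=> p; rewrite !ffunE mulrDr; congr (_ + _).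
exact: mulrCA.
Qed.

HB.instance Definition _ x :=
  GRing.isLinear.Build K (ext W) (tens V W) _ (tensor x) (tensor_linear x).

Lemma tensor_suml y (I : Type) (r : seq I) (P : pred I) (c : I -> K)
    (F : I -> ext V) :
  tensor (\sum_(i <- r | P i) c i *: F i) y =
  \sum_(i <- r | P i) c i *: tensor (F i) y.
Proof.
apply/ffunP=> p; rewrite !ffunE !sum_ffunE mulr_suml.
by apply: eq_bigr => i _; rewrite !ffunE -mulrA.
Qed.

Lemma tens_sum t : t = \sum_p t p *: tensor (ebase p.1) (ebase p.2).
Proof.
apply/ffunP=> p; rewrite sum_ffunE (bigD1 p) //= big1 ?addr0 => [|q neqp].
  by rewrite !ffunE !eqxx mulr1 [RHS]mulr1.
rewrite !ffunE -natrM mulnb -xpair_eqE -!surjective_pairing eq_sym (negPf neqp).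
by rewrite [LHS]mulr0.
Qed.

Lemma mem_tensv (X : {vspace ext V}) (Y : {vspace ext W}) x y :
  x \in X -> y \in Y -> tensor x y \in tensv X Y.
Proof.
move=> Xx Yy; rewrite (coord_vbasis Xx) tensor_suml; apply: memv_suml => i _.
rewrite (coord_vbasis Yy) linear_sum; apply: memvZ; apply: memv_suml => j _.
rewrite linearZ; apply: memvZ; apply: memv_span; apply/allpairsP.
by exists ((vbasis X)`_i, (vbasis Y)`_j); split=> //; apply: mem_nth;
   rewrite size_tuple.
Qed.

Lemma tensvP (X : {vspace ext V}) (Y : {vspace ext W}) (Z : {vspace tens V W}) :
  (forall x y, x \in X -> y \in Y -> tensor x y \in Z) -> (tensv X Y <= Z)%VS.
Proof.
move=> XYZ; apply/span_subvP=> _ /allpairsP[p [Xp Yp ->]].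
exact: XYZ (vbasis_mem Xp) (vbasis_mem Yp).
Qed.

End Tensor.

Section TensorMaps.
Variable K : fieldType.
Implicit Types V W : vectType K.

Lemma tmap_tensor V W V' W' (f : 'Hom(ext V, ext V')) (g : 'Hom(ext W, ext W'))
    x y :
  tmap f g (tensor x y) = tensor (f x) (g y).
Proof.
have fx : f x = \sum_B x B *: f (ebase B).
  by rewrite {1}(ext_sum x) linear_sum; apply: eq_bigr => B _; rewrite linearZ.
have gy : g y = \sum_B y B *: g (ebase B).
  by rewrite {1}(ext_sum y) linear_sum; apply: eq_bigr => B _; rewrite linearZ.
rewrite fx tensor_suml tmapE /= /tmap_fun.
transitivity (\sum_B \sum_C (x B * y C) *: tensor (f (ebase B)) (g (ebase C))).
  by rewrite pair_big; apply: eq_bigr => p _; rewrite ffunE.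
apply: eq_bigr => B _; rewrite gy linear_sum scaler_sumr.
by apply: eq_bigr => C _; rewrite linearZ scalerA.
Qed.

Lemma eq_in_tensv V W (U : vectType K) (X : {vspace ext V}) (Y : {vspace ext W})
    (f g : 'Hom(tens V W, U)) :
  (forall x y, x \in X -> y \in Y -> f (tensor x y) = g (tensor x y)) ->
  {in tensv X Y, f =1 g}.
Proof.
by move=> eq_fg; apply/eqlfun_inP; apply: tensvP => x y Xx Yy; apply/eqlfunP/eq_fg.
Qed.

Lemma limg_tmap V W V' W' (f : 'Hom(ext V, ext V')) (g : 'Hom(ext W, ext W')) X Y :
  (tmap f g @: tensv X Y)%VS = tensv (f @: X) (g @: Y).
Proof.
apply/eqP; rewrite eqEsubv; apply/andP; split.
  rewrite limg_span; apply/span_subvP=> _ /mapP[_ /allpairsP[p [Xp Yp ->]] ->].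
  by rewrite tmap_tensor mem_tensv ?memv_img ?vbasis_mem.
apply: tensvP => _ _ /memv_imgP[x Xx ->] /memv_imgP[y Yy ->].
by rewrite -tmap_tensor memv_img ?mem_tensv.
Qed.

Lemma lfun_tens_eq V W (U : vectType K) (f g : 'Hom(tens V W, U)) :
  (forall x y, f (tensor x y) = g (tensor x y)) -> f = g.
Proof.
move=> eq_fg; apply/lfunP=> t; rewrite (tens_sum t) !linear_sum.
by apply: eq_bigr => p _; rewrite !linearZ /= eq_fg.
Qed.

Lemma tmap_comp V W V' W' V'' W''
    (f : 'Hom(ext V, ext V')) (g : 'Hom(ext W, ext W'))
    (f' : 'Hom(ext V', ext V'')) (g' : 'Hom(ext W', ext W'')) :
  (tmap f' g' \o tmap f g)%VF = tmap (f' \o f) (g' \o g).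
Proof.
by apply: lfun_tens_eq => x y; rewrite comp_lfunE !tmap_tensor !comp_lfunE.
Qed.

Lemma tmap_id V W : tmap \1%VF \1%VF = \1%VF :> 'End(tens V W).
Proof. by apply: lfun_tens_eq => x y; rewrite tmap_tensor !id_lfunE. Qed.

Lemma tmap_ker0 V W V' W' (f : 'Hom(ext V, ext V')) (g : 'Hom(ext W, ext W')) :
  lker f == 0%VS -> lker g == 0%VS -> lker (tmap f g) == 0%VS.
Proof.
move=> kerf kerg; apply/lker0P; apply: (can_inj (g := tmap f^-1 g^-1)) => t.
by rewrite -comp_lfunE tmap_comp !lker0_compVf // tmap_id id_lfunE.
Qed.

End TensorMaps.

(** * Orthogonal projections *)

Section OrthogonalProjection.
Variables (K : fieldType) (V : vectType K) (f : {symmetric V}).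
Implicit Types (U : {vspace V}) (u v w : V).

Lemma sformC u v : f u v = f v u.
Proof. by have := hermC f u v; rewrite expr0 mul1r. Qed.

Lemma mem_orthov U v : (forall u, u \in U -> f v u = 0) -> v \in orthov f U.
Proof. by move=> fU; apply/mem_orthovP=> u Uu; rewrite fU. Qed.

Lemma form_orthov U v u : v \in orthov f U -> u \in U -> f v u = 0.
Proof. by move/mem_orthovP; apply. Qed.

Lemma dim_orthov_ge U : (\dim {:V} <= \dim U + \dim (orthov f U))%N.
Proof.
pose phi (v : V) : 'rV[K]_(\dim U) := \row_i f v (tnth (vbasis U) i).
have phi_lin : linear phi.
  by move=> a u v; apply/rowP=> i; rewrite !mxE linearPl.
pose L := GRing.isLinear.Build K V 'rV[K]_(\dim U) _ _ phi_lin.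
pose phiL : {linear V -> 'rV[K]_(\dim U)} := HB.pack phi L.
rewrite -(limg_ker_dim (linfun phiL) {:V}) addnC leq_add //.
  by apply: leq_trans (dimvS (subvf _)) _; rewrite dimvf dim_matrix mul1r.
apply: dimvS; apply/subvP=> v /memv_capP[_]; rewrite memv_ker lfunE /= => /eqP v0.
apply: mem_orthov => u /coord_vbasis ->; rewrite linear_sumr big1 // => i _.
have := congr1 (fun r : 'rV_ _ => r 0 i) v0; rewrite !mxE (tnth_nth 0) => v0i.
by rewrite linearZr /= v0i mulr0.
Qed.

Section Nondegenerate.
Variable U : {vspace V}.
Hypothesis ndU : nondegenerate_on f U.

Lemma dim_orthov : (\dim U + \dim (orthov f U))%N = \dim {:V}.
Proof.
apply/eqP; rewrite eqn_leq dim_orthov_ge andbT.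
by rewrite -(dimv_disjoint_sum ndU) dimvS ?subvf.
Qed.

Lemma addv_orthov : (U + orthov f U)%VS = fullv.
Proof.
by apply/eqP; rewrite eqEdim subvf (dimv_disjoint_sum ndU) dim_orthov leqnn.
Qed.

Lemma oproj_mem v : oproj f U v \in U. Proof. exact: memv_pi. Qed.

Lemma oproj_form v u : u \in U -> f (oproj f U v) u = f v u.
Proof.
move=> Uu; have := daddv_pi_add (w := v) ndU; rewrite addv_orthov memvf.
move=> /(_ isT) def_v; rewrite -{2}def_v linearDl /=.
have Ov : daddv_pi (orthov f U) U v \in orthov f U by apply: memv_pi.
by rewrite (form_orthov Ov Uu) addr0.
Qed.

Lemma form_inj v w : v \in U -> w \in U ->
  (forall u, u \in U -> f v u = f w u) -> v = w.
Proof.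
move=> Uv Uw eq_vw; apply/eqP; rewrite -subr_eq0 -memv0 -ndU memv_cap memvB //=.
by apply: mem_orthov => u Uu; rewrite linearBl /= eq_vw // subrr.
Qed.

Lemma oproj_uniq v w :
  w \in U -> (forall u, u \in U -> f w u = f v u) -> oproj f U v = w.
Proof.
move=> Uw fw; apply: form_inj => // [|u Uu]; first exact: oproj_mem.
by rewrite oproj_form // fw.
Qed.

End Nondegenerate.
End OrthogonalProjection.

Local Notation form := Defs.form.

(** * The intersection and relation spaces of an arrangement *)

Section ArrangementSpaces.
Variables (K : fieldType) (V : vectType K) (n : nat) (A : arrangement V n).
Implicit Types (S U : {set 'I_n}) (r : 'I_n) (w : 'rV[K]_n).

Lemma HspP U x :
  reflect (forall r, r \in U -> form A x (nu A r) = 0) (x \in Hsp A U).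
Proof.
rewrite memvE; apply: (iffP subv_bigcapP) => Hx r Ur.
  by have := Hx r Ur; rewrite -memvE mem_orthov1 => /eqP.
by rewrite -memvE mem_orthov1 Hx.
Qed.

Lemma HspU1 r U x :
  (x \in Hsp A (r |: U)) = (x \in Hsp A U) && (form A x (nu A r) == 0).
Proof.
apply/HspP/andP => [Hx | [/HspP Hx /eqP xr] s].
  split; last by rewrite Hx ?eqxx // !inE eqxx.
  by apply/HspP=> s Us; apply: Hx; rewrite !inE Us orbT.
by rewrite !inE => /predU1P[-> //|]; apply: Hx.
Qed.

Lemma sub_HspU1 r U : (Hsp A (r |: U) <= Hsp A U)%VS.
Proof. by apply/subvP=> x; rewrite HspU1 => /andP[]. Qed.

Lemma nu_Vsp r U : r \in U -> nu A r \in Vsp A U.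
Proof. by move=> Ur; rewrite memvE; apply: (sumv_sup r). Qed.

Lemma form_Hsp_Vsp U x v : x \in Hsp A U -> v \in Vsp A U -> form A x v = 0.
Proof.
move=> /HspP Hx /memv_sumP[u Pu ->]; rewrite linear_sumr big1 // => r Ur.
by have /vlineP[c ->] := Pu r Ur; rewrite linearZr /= Hx ?mulr0.
Qed.

Lemma Hsp_orthov U : Hsp A U = orthov (form A) (Vsp A U).
Proof.
apply/vspaceP=> x; apply/idP/idP => [Hx | Ox].
  by apply: mem_orthov => v; apply: form_Hsp_Vsp.
by apply/HspP=> r Ur; apply: form_orthov Ox (nu_Vsp Ur).
Qed.

(** V_U is contained in the orthogonal complement of H_U, and nondegeneracy on
    H_U bounds the dimension of the latter. *)
Lemma Hsp_orthovK U :
  nondegenerate_on (form A) (Hsp A U) -> orthov (form A) (Hsp A U) = Vsp A U.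
Proof.
move=> ndH; apply/esym/eqP; rewrite eqEdim; apply/andP; split.
  apply/subvP=> v Vv; apply: mem_orthov => x Hx.
  by rewrite sformC (form_Hsp_Vsp Hx).
rewrite -(leq_add2l (\dim (Hsp A U))) dim_orthov // [in leqRHS]Hsp_orthov addnC.
exact: dim_orthov_ge.
Qed.

Lemma HspU1_id r U : nu A r \in Vsp A U -> Hsp A (r |: U) = Hsp A U.
Proof.
move=> Vr; apply/vspaceP=> x; rewrite HspU1; case: (boolP (_ \in _)) => //= Hx.
by rewrite (form_Hsp_Vsp Hx) ?eqxx.
Qed.

Lemma dim_HspU1 r U : nondegenerate_on (form A) (Hsp A U) ->
  nu A r \notin Vsp A U -> \dim (Hsp A U) = (\dim (Hsp A (r |: U))).+1.
Proof.
move=> ndH; rewrite -(Hsp_orthovK ndH) => Or.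
have <- : (Hsp A U :&: orthov (form A) <[nu A r]>)%VS = Hsp A (r |: U).
  by apply/vspaceP=> x; rewrite memv_cap mem_orthov1 HspU1.
rewrite -(eq_dim_orthov1 Or) prednK // lt0n dimv_eq0.
have /mem_orthovPn[x Hx] := Or; apply: contra_neq => H0.
by move: Hx; rewrite H0 memv0 => /eqP->; rewrite linear0r.
Qed.

Lemma lincombE w : lincomb A w = \sum_i w 0 i *: nu A i.
Proof. by rewrite lfunE. Qed.

Lemma WspP U w : reflect (lincomb A w = 0 /\ (forall i, i \notin U -> w 0 i = 0))
  (w \in Wsp A U).
Proof.
rewrite memv_cap !memv_ker [linfun (outside_fun U) w]lfunE /=; apply: (iffP andP).
  move=> [/eqP w0 /eqP out0]; split=> // i Ui.
  by have := congr1 (fun v : 'rV_n => v 0 i) out0; rewrite !mxE (negPf Ui).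
move=> [w0 out0]; split; apply/eqP=> //; apply/rowP=> i.
by rewrite !mxE; case: ifPn => // /out0.
Qed.

Lemma WspU1 r U w : r \notin U ->
  (w \in Wsp A U) = (w \in Wsp A (r |: U)) && (w 0 r == 0).
Proof.
move=> Ur; apply/WspP/andP => [[w0 out0] | [/WspP[w0 out0] /eqP wr]].
  rewrite out0 // eqxx; split=> //; apply/WspP; split=> // i.
  by rewrite !inE negb_or => /andP[_]; apply: out0.
split=> // i Ui; have [-> //|neq_ir] := eqVneq i r.
by rewrite out0 // !inE negb_or neq_ir.
Qed.

Lemma sub_WspU1 r U : (Wsp A U <= Wsp A (r |: U))%VS.
Proof.
apply/subvP=> w /WspP[w0 out0]; apply/WspP; split=> // i.
by rewrite !inE negb_or => /andP[_]; apply: out0.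
Qed.

Lemma sub_WspT U : (Wsp A U <= Wsp A setT)%VS.
Proof.
by apply/subvP=> w /WspP[w0 _]; apply/WspP; split=> // i; rewrite inE.
Qed.

(** A relation whose r-th coefficient is nonzero can be solved for nu_r. *)
Lemma Vsp_relP r U : r \notin U ->
  reflect (exists2 w, w \in Wsp A (r |: U) & w 0 r != 0) (nu A r \in Vsp A U).
Proof.
move=> Ur; apply: (iffP idP) => [|[w /WspP[w0 out0] wr]].
  case/memv_sumP=> u Pu def_r.
  have /fin_all_exists[c def_u] s : exists c, s \in U -> u s = c *: nu A s.
    by case Us: (s \in U); [case/vlineP: (Pu s Us) => c; exists c | exists 0].
  pose w : 'rV[K]_n := \row_i (if i == r then -1 else if i \in U then c i else 0).
  exists w; last by rewrite mxE eqxx oppr_eq0 oner_eq0.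
  apply/WspP; split=> [|i]; last first.
    by rewrite !inE mxE negb_or => /andP[/negPf-> /negPf->].
  rewrite lincombE (bigD1 r) //= mxE eqxx scaleN1r addrC; apply/eqP.
  rewrite subr_eq0 eq_sym {1}def_r big_mkcond [X in _ == X]big_mkcond /=.
  apply/eqP/eq_bigr => i _; rewrite mxE; case: eqVneq => [->|_] /=.
    by rewrite (negPf Ur).
  by case: ifP => [/def_u->|]; rewrite ?scale0r.
rewrite -[nu A r](scalerK wr) memvZ //.
move/eqP: w0; rewrite lincombE (bigD1 r) //= addr_eq0 => /eqP->.
rewrite memvN; apply: memv_suml => i neq_ir.
case: (boolP (i \in U)) => [/nu_Vsp Vi | Ui]; first exact: memvZ.
by rewrite out0 ?scale0r ?mem0v // !inE negb_or neq_ir.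
Qed.

Lemma WspU1_id r U : r \notin U -> nu A r \notin Vsp A U ->
  Wsp A (r |: U) = Wsp A U.
Proof.
move=> Ur /(Vsp_relP Ur) Vr; apply/vspaceP=> w; rewrite (WspU1 _ Ur).
case: (boolP (w \in _)) => //= Ww; apply/esym/negPn/negP=> wr.
by case: Vr; exists w.
Qed.

Lemma dim_WspU1 r U : r \notin U -> nu A r \in Vsp A U ->
  \dim (Wsp A (r |: U)) = (\dim (Wsp A U)).+1.
Proof.
move=> Ur /(Vsp_relP Ur)[w Ww wr].
pose coordr (v : 'rV[K]_n) : K^o := v 0 r.
have coordr_lin : linear coordr by move=> a u v; rewrite /coordr !mxE.
pose L := GRing.isLinear.Build K 'rV[K]_n K^o _ _ coordr_lin.
pose phi : {linear 'rV[K]_n -> K^o} := HB.pack coordr L.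
rewrite -(limg_ker_dim (linfun phi)) -[RHS]addn1; congr (\dim _ + _)%N.
  apply/vspaceP=> v; rewrite (WspU1 _ Ur) memv_cap memv_ker; congr (_ && _).
  by rewrite lfunE.
apply/eqP; rewrite eqn_leq; apply/andP; split.
  by apply: leq_trans (dimvS (subvf _)) _; rewrite dimvf.
rewrite lt0n dimv_eq0; apply: contra_neq wr => img0.
have : linfun phi w \in (linfun phi @: Wsp A (r |: U))%VS by rewrite memv_img.
by rewrite img0 memv0 lfunE /= => /eqP.
Qed.

Lemma dot_delta r w : dot (delta_mx 0 r) w = w 0 r.
Proof.
rewrite /dot (bigD1 r) //= big1 ?addr0 => [|i neq_ir]; rewrite mxE ?eqxx ?mul1r //.
by rewrite (negPf neq_ir) mul0r.
Qed.

End ArrangementSpaces.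

(** * The cube of an arrangement is graded *)

Section TensorGrading.
Variables (K : fieldType) (V W : vectType K).

Lemma extpow_coef0 (U : vectType K) (H : {vspace U}) i (x : ext U)
    (B : {set 'I_(\dim {:U})}) :
  x \in extpow H i -> #|B| != i -> x B = 0.
Proof.
move=> /(coord_span (X := in_tuple _)) -> neqB; rewrite sum_ffunE big1 // => k _.
rewrite ffunE; set s := in_tuple _; have /mapP[t _ ->] : s`_k \in s.
  exact: mem_nth.
by rewrite wedge_coef0 ?scaler0 // size_map size_tuple.
Qed.

Definition tgr_fun (P : pred nat) (t : tens V W) : tens V W :=
  [ffun p : {set 'I_(\dim {:V})} * {set 'I_(\dim {:W})} =>
     if P (#|p.1| + #|p.2|)%N then t p else 0].

Fact tgr_linear P : linear (tgr_fun P).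
Proof.
move=> a u v; apply/ffunP=> p; rewrite !ffunE.
by case: ifP => // _; rewrite scaler0 addr0.
Qed.

HB.instance Definition _ P :=
  GRing.isLinear.Build K (tens V W) (tens V W) _ (tgr_fun P) (tgr_linear P).

Definition tgr P : 'End(tens V W) := linfun (tgr_fun P).

Lemma tgr_tensv P H i H' j : {in tensv (extpow H i) (extpow H' j), forall t,
  tgr P t = if P (i + j)%N then t else 0}.
Proof.
move=> t Ht.
transitivity (((P (i + j)%N)%:R *: \1%VF : 'End(tens V W)) t); last first.
  by rewrite scale_lfunE id_lfunE; case: ifP => _; rewrite ?scale1r ?scale0r.
move: t Ht; apply: eq_in_tensv => x y Hx Hy; rewrite scale_lfunE id_lfunE lfunE /=.
apply/ffunP=> p; rewrite !ffunE.
have [eq_i|neq_i] := eqVneq #|p.1| i; last first.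
  by rewrite (extpow_coef0 Hx neq_i) mul0r scaler0 if_same.
have [eq_j|neq_j] := eqVneq #|p.2| j; last first.
  by rewrite (extpow_coef0 Hy neq_j) mulr0 scaler0 if_same.
by rewrite eq_i eq_j; case: ifP => _; rewrite ?scale1r ?scale0r.
Qed.

End TensorGrading.

Section CubeGrading.
Variables (K : fieldType) (V : vectType K) (n : nat) (A : arrangement V n).
Hypothesis regA : regular A.
Implicit Types (S U : {set 'I_n}) (r : 'I_n).

Local Notation dotn := (@dot K n).

Lemma regH U : nondegenerate_on (form A) (Hsp A U). Proof. by case: (regA U). Qed.
Lemma regW U : nondegenerate_on dotn (Wsp A U). Proof. by case: (regA U). Qed.

(** Projecting the r-th basis vector first to W and then to W_U does not change
    its pairing with vectors of W_U. *)
Lemma dot_nuv r U w :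
  w \in Wsp A U -> dot (oproj dotn (Wsp A U) (nuv A r)) w = w 0 r.
Proof.
move=> Ww; rewrite (oproj_form (regW U)) // (oproj_form (regW setT)).
  exact: dot_delta.
exact: subvP (sub_WspT A U) _ Ww.
Qed.

Lemma tildeU_pos r S : r \in pos A -> tilde A (r |: S) = r |: tilde A S.
Proof.
move=> pr; apply/setP=> i; rewrite !inE.
by case: eqVneq => [->|] //=; rewrite pr.
Qed.

Lemma tilde_pos r S : r \in pos A -> r \notin S -> r \notin tilde A S.
Proof. by move=> pr /negPf Sr; rewrite !inE pr Sr andbF. Qed.

Lemma tildeU_neg r S : r \notin pos A -> tilde A (r |: S) = tilde A S :\ r.
Proof.
move=> /negPf pr; apply/setP=> i; rewrite !inE.
by case: eqVneq => [->|] //=; rewrite pr.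
Qed.

Lemma tilde_neg r S : r \notin pos A -> r \notin S -> r \in tilde A S.
Proof. by move=> /negPf pr Sr; rewrite !inE pr Sr orbT. Qed.

Lemma tens_qpiece S i j :
  (tensv (extpow (Hsp A (tilde A S)) i) (extpow (Wsp A (tilde A S)) j) <=
   @qpiece K n (Tcube A) S (qdeg (Tcube A) S (i + j)))%VS.
Proof.
case: (leqP i (\dim (Hsp A (tilde A S)))) => [le_i | /extpow_gt_dim->]; last first.
  apply: tensvP => x y; rewrite memv0 => /eqP-> _.
  by rewrite (_ : tensor 0 y = 0) ?mem0v //; apply/ffunP=> p; rewrite !ffunE mul0r.
case: (leqP j (\dim (Wsp A (tilde A S)))) => [le_j | /extpow_gt_dim->]; last first.
  by apply: tensvP => x y _; rewrite memv0 => /eqP->; rewrite linear0 mem0v.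
have lt_ij : (i + j < (topdeg (Tcube A) S).+1)%N by rewrite ltnS leq_add.
apply: (sumv_sup (Ordinal lt_ij)) => //=.
have lt_i : (i < (i + j).+1)%N by rewrite ltnS leq_addr.
by apply: (sumv_sup (Ordinal lt_i)); rewrite //= addKn.
Qed.

Lemma tmap_piece S S' f g di dj k :
  (forall i, f @: extpow (Hsp A (tilde A S)) i <=
             extpow (Hsp A (tilde A S')) (di + i))%VS ->
  (forall j, g @: extpow (Wsp A (tilde A S)) j <=
             extpow (Wsp A (tilde A S')) (dj + j))%VS ->
  qdeg (Tcube A) S' (di + dj + k) = qdeg (Tcube A) S k ->
  (tmap f g @: piece (Tcube A) S k <=
     @qpiece K n (Tcube A) S' (qdeg (Tcube A) S k))%VS.
Proof.
move=> Hf Wg <-; rewrite limg_sum; apply/subv_sumP=> i _; rewrite limg_tmap.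
have le_ik : (i <= k)%N by rewrite -ltnS.
have -> : (di + dj + k = (di + i) + (dj + (k - i)))%N by rewrite addnACA subnKC.
apply: subv_trans (tens_qpiece _ _ _); apply: tensvP => x y Hx Wy.
by apply: mem_tensv; [apply: subvP (Hf i) _ Hx | apply: subvP (Wg _) _ Wy].
Qed.

Lemma limg_Hproj (X : {vspace V}) U i :
  (Hproj A U @: extpow X i <= extpow (Hsp A U) i)%VS.
Proof.
rewrite /Hproj limg_extmap extpowS //; apply/subvP=> _ /memv_imgP[x _ ->].
exact: oproj_mem.
Qed.

Lemma limg_Wproj X U i : (Wproj A U @: extpow X i <= extpow (Wsp A U) i)%VS.
Proof.
rewrite /Wproj limg_extmap extpowS //; apply/subvP=> _ /memv_imgP[x _ ->].
exact: oproj_mem.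
Qed.

(** In each of the four cases exactly one of dim H and dim W changes, by one: it
    increases when the edge map wedges with a vector, which raises the exterior
    degree by one, and decreases otherwise. *)
Lemma edge_piece S r k : r \notin S ->
  (edge (Tcube A) S r @: piece (Tcube A) S k <=
     @qpiece K n (Tcube A) (r |: S) (qdeg (Tcube A) S k))%VS.
Proof.
move=> Sr; rewrite -[edge _ _ _]/(delta A S r) /delta.
have cardS : #|r |: S| = #|S|.+1 by rewrite cardsU1 Sr.
case: ifPn => pr.
  have tr := tilde_pos pr Sr; set U := tilde A S in tr *.
  have trS : tilde A (r |: S) = r |: U by rewrite tildeU_pos.
  case: ifPn => Vr.
    have Wid := WspU1_id tr Vr; have dH := dim_HspU1 (regH U) Vr.
    apply: (tmap_piece (di := 0%N) (dj := 0%N)) => [i|j|].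
    - by rewrite trS; apply: limg_Hproj.
    - by rewrite trS lim1g Wid.
    by rewrite /qdeg /= trS -/U Wid dH cardS !addSn -!natr1; ring.
  have {}Vr := negbNE Vr.
  have Hid := HspU1_id Vr; have dW := dim_WspU1 tr Vr.
  apply: (tmap_piece (di := 0%N) (dj := 1%N)) => [i|j|].
  - by rewrite trS; apply: limg_Hproj.
  - rewrite trS -/U; apply: subv_trans (limgS _ (extpowS _ (sub_WspU1 A r U))) _.
    by apply: lwedge_extpow; apply: oproj_mem.
  by rewrite /qdeg /= trS -/U Hid dW cardS !addnS !addSn -!natr1; ring.
have tr := tilde_neg pr Sr.
have trS : tilde A (r |: S) = tilde A S :\ r by rewrite tildeU_neg.
set U := tilde A S :\ r in trS *; have tU : r \notin U by rewrite !inE eqxx.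
have defU : tilde A S = r |: U by rewrite setD1K.
case: ifPn => Vr.
  have Hid := HspU1_id Vr; have dW := dim_WspU1 tU Vr.
  apply: (tmap_piece (di := 0%N) (dj := 0%N)) => [i|j|].
  - by rewrite trS defU lim1g Hid.
  - by rewrite trS; apply: limg_Wproj.
  by rewrite /qdeg /= trS defU Hid dW cardS !addnS -!natr1; ring.
have Wid := WspU1_id tU Vr; have dH := dim_HspU1 (regH U) Vr.
apply: (tmap_piece (di := 1%N) (dj := 0%N)) => [i|j|].
- rewrite trS defU; apply: subv_trans (limgS _ (extpowS _ (sub_HspU1 A r U))) _.
  by apply: lwedge_extpow; apply: oproj_mem.
- by rewrite trS; apply: limg_Wproj.
by rewrite /qdeg /= trS defU Wid dH cardS !addSn -!natr1; ring.
Qed.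

Definition Tcube_pi S q : 'End(amb (Tcube A)) :=
  tgr V 'rV[K]_n (fun k => qdeg (Tcube A) S k == q).

Lemma Tcube_qgrading : qgrading Tcube_pi.
Proof.
apply: piece_qgrading => [S q k x _ | S r k Sr _]; last exact: edge_piece.
case/memv_sumP=> u Pu ->; rewrite linear_sum /=.
rewrite (eq_bigr (fun i : 'I_k.+1 => if qdeg (Tcube A) S k == q then u i else 0)).
  by case: ifP => // _; rewrite big1.
move=> i _; have le_ik : (i <= k)%N by rewrite -ltnS.
by rewrite /Tcube_pi (tgr_tensv _ (Pu i isT)) subnKC.
Qed.

End CubeGrading.

(** * Comparing the cube of an arrangement with a facet of a larger cube *)

Section VertexMaps.
Variables (K : fieldType) (V : vectType K) (n : nat) (A : arrangement V n).

Lemma vertex_tensP S (Z : {vspace tens V 'rV[K]_n}) :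
  (forall i j x y, x \in extpow (Hsp A (tilde A S)) i ->
     y \in extpow (Wsp A (tilde A S)) j -> tensor x y \in Z) ->
  (vertex (Tcube A) S <= Z)%VS.
Proof.
move=> HWZ; apply/subv_sumP=> k _; apply/subv_sumP=> i _; apply: tensvP => x y.
exact: HWZ.
Qed.

Lemma eq_in_vertex S (U : vectType K) (f g : 'Hom(tens V 'rV[K]_n, U)) :
  (forall i j x y, x \in extpow (Hsp A (tilde A S)) i ->
     y \in extpow (Wsp A (tilde A S)) j -> f (tensor x y) = g (tensor x y)) ->
  {in vertex (Tcube A) S, f =1 g}.
Proof.
move=> eq_fg; apply/eqlfun_inP; apply: vertex_tensP => i j x y Hx Wy.
by apply/eqlfunP; apply: eq_fg Hx Wy.
Qed.

End VertexMaps.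

Section Comparison.
Variables (K : fieldType) (V V' : vectType K) (n : nat).
Variables (A : arrangement V n.+1) (A' : arrangement V' n) (l : 'I_n.+1).
Variables b c : bool.
Hypotheses (regA : regular A) (regA' : regular A').
Implicit Types (U S : {set 'I_n}) (r : 'I_n).

Local Notation fset U := (facet_set l b U).

Hypothesis pos_lift : forall r, (lift l r \in pos A) = (r \in pos A').
Hypothesis tilde_facet : forall S, tilde A (facet_set l c S) = fset (tilde A' S).

Variables (a : 'Hom(V', V)) (iota : 'Hom('rV[K]_n, 'rV[K]_n.+1)).
Hypothesis a_ker0 : lker a == 0%VS.
Hypothesis a_Hsp : forall U, (a @: Hsp A' U)%VS = Hsp A (fset U).
Hypothesis a_form : forall x y, form A (a x) (a y) = form A' x y.
Hypothesis a_nu : forall x r, form A (a x) (nu A (lift l r)) = form A' x (nu A' r).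
Hypothesis iota_ker0 : lker iota == 0%VS.
Hypothesis iota_Wsp : forall U, (iota @: Wsp A' U)%VS = Wsp A (fset U).
Hypothesis iota_coord : forall w r, iota w 0 (lift l r) = w 0 r.

(** iota need not preserve the inner products of the relation spaces.  The maps
    phi U are inverse to its adjoints.  Projections and the vectors nu_r^vee are
    adjoint to inclusions and coordinates, which commute with iota; hence it is
    phi that carries them from one arrangement to the other. *)
Variable phi : {set 'I_n} -> 'Hom('rV[K]_n, 'rV[K]_n.+1).
Hypothesis phi_ker0 : forall U, lker (phi U) == 0%VS.
Hypothesis phi_Wsp : forall U w, w \in Wsp A' U -> phi U w \in Wsp A (fset U).
Hypothesis phi_dot : forall U w v, w \in Wsp A' U -> v \in Wsp A' U ->
  dot (phi U w) (iota v) = dot w v.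

Local Notation ndH := (regH regA).
Local Notation ndW := (regW regA).
Local Notation ndH' := (regH regA').
Local Notation ndW' := (regW regA').

Lemma iota_WspP U v :
  v \in Wsp A (fset U) -> exists2 w, w \in Wsp A' U & v = iota w.
Proof. by rewrite -iota_Wsp => /memv_imgP. Qed.

Lemma a_HspP U x : x \in Hsp A (fset U) -> exists2 y, y \in Hsp A' U & x = a y.
Proof. by rewrite -a_Hsp => /memv_imgP. Qed.

Lemma dim_Wsp_facet U : \dim (Wsp A (fset U)) = \dim (Wsp A' U).
Proof.
by rewrite -iota_Wsp limg_dim_eq // (eqP iota_ker0) capv0.
Qed.

Lemma dim_Hsp_facet U : \dim (Hsp A (fset U)) = \dim (Hsp A' U).
Proof. by rewrite -a_Hsp limg_dim_eq // (eqP a_ker0) capv0. Qed.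

Lemma limg_phi U : (phi U @: Wsp A' U)%VS = Wsp A (fset U).
Proof.
apply/eqP; rewrite eqEdim dim_Wsp_facet limg_dim_eq; last first.
  by rewrite (eqP (phi_ker0 U)) capv0.
rewrite leqnn andbT; apply/subvP=> _ /memv_imgP[w Ww ->].
exact: phi_Wsp.
Qed.

Lemma Vsp_facet r U : r \notin U ->
  (nu A (lift l r) \in Vsp A (fset U)) = (nu A' r \in Vsp A' U).
Proof.
move=> Ur; have lUr : lift l r \notin fset U by rewrite lift_facet_set.
apply/idP/idP=> [/(Vsp_relP A lUr)|/(Vsp_relP A' Ur)] [w]; rewrite -?facet_setU1.
  case/iota_WspP=> v Wv -> vr; apply/(Vsp_relP A' Ur).
  by exists v; rewrite // -iota_coord.
move=> Ww wr; apply/(Vsp_relP A lUr); exists (iota w); rewrite ?iota_coord //.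
by rewrite -facet_setU1 -iota_Wsp memv_img.
Qed.

Lemma a_oproj U x :
  a (oproj (form A') (Hsp A' U) x) = oproj (form A) (Hsp A (fset U)) (a x).
Proof.
apply/esym/(oproj_uniq (ndH _)) => [|_ /a_HspP[y Hy ->]].
  by rewrite -a_Hsp memv_img ?oproj_mem.
by rewrite !a_form (oproj_form (ndH' U)).
Qed.

Lemma a_oproj_nu U r : a (oproj (form A') (Hsp A' U) (nu A' r)) =
  oproj (form A) (Hsp A (fset U)) (nu A (lift l r)).
Proof.
apply/esym/(oproj_uniq (ndH _)) => [|_ /a_HspP[y Hy ->]].
  by rewrite -a_Hsp memv_img ?oproj_mem.
by rewrite a_form (oproj_form (ndH' U)) // sformC -a_nu sformC.
Qed.

Lemma phi_nuv U r : phi U (oproj (@dot K n) (Wsp A' U) (nuv A' r)) =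
  oproj (@dot K n.+1) (Wsp A (fset U)) (nuv A (lift l r)).
Proof.
apply: (form_inj (ndW (fset U))); rewrite ?phi_Wsp ?oproj_mem //.
move=> _ /iota_WspP[w Ww ->]; rewrite /= phi_dot ?oproj_mem //.
by rewrite !dot_nuv // ?iota_coord // -iota_Wsp memv_img.
Qed.

Lemma phi_oproj U r w : w \in Wsp A' (r |: U) ->
  phi U (oproj (@dot K n) (Wsp A' U) w) =
  oproj (@dot K n.+1) (Wsp A (fset U)) (phi (r |: U) w).
Proof.
move=> Ww; apply: (form_inj (ndW (fset U))); rewrite ?phi_Wsp ?oproj_mem //.
move=> _ /iota_WspP[v Wv ->]; rewrite /= phi_dot ?oproj_mem //.
rewrite (oproj_form (ndW' U)) // (oproj_form (ndW (fset U))); last first.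
  by rewrite -iota_Wsp memv_img.
by rewrite /= phi_dot // (subvP (sub_WspU1 _ _ _)).
Qed.

Lemma dot_phiU1 U r w v : w \in Wsp A' U -> v \in Wsp A' U ->
  dot (phi (r |: U) w - phi U w) (iota v) = 0.
Proof.
move=> Ww Wv; have sW := subvP (sub_WspU1 A' r U).
by rewrite linearBl /= !phi_dot ?sW // subrr.
Qed.

Lemma phiU1_id U r w : r \notin U -> nu A' r \notin Vsp A' U -> w \in Wsp A' U ->
  phi (r |: U) w = phi U w.
Proof.
move=> Ur Vr Ww; have Wid := WspU1_id Ur Vr.
have Wid2 : Wsp A (fset (r |: U)) = Wsp A (fset U) by rewrite -!iota_Wsp Wid.
apply: (form_inj (ndW (fset U))); rewrite ?phi_Wsp //.
  by rewrite -Wid2 phi_Wsp // Wid.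
move=> _ /iota_WspP[v Wv ->]; apply/eqP; rewrite -subr_eq0 -linearBl /=.
by rewrite dot_phiU1.
Qed.

(** The difference is orthogonal to iota W_U, and the vectors of W_(r |: U) with
    this property are the multiples of the one that represents the r-th
    coordinate.  They die in the wedge product with it. *)
Lemma phiU1_mod U r w : r \notin U -> nu A' r \in Vsp A' U -> w \in Wsp A' U ->
  phi (r |: U) w - phi U w \in
    <[oproj (@dot K n.+1) (Wsp A (fset (r |: U))) (nuv A (lift l r))]>%VS.
Proof.
move=> Ur /(Vsp_relP A' Ur)[v0 Wv0 v0r] Ww; set d := phi _ w - _.
have sW := subvP (sub_WspU1 A' r U).
have Wd : d \in Wsp A (fset (r |: U)).
  rewrite memvB ?phi_Wsp ?sW // facet_setU1.
  by apply: subvP (sub_WspU1 _ _ _) _ _; apply: phi_Wsp.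
apply/vlineP; exists (dot d (iota v0) / v0 0 r).
apply: (form_inj (ndW _) Wd); first by rewrite memvZ ?oproj_mem.
move=> u Wu; rewrite linearZl_LR /= dot_nuv //.
have [v Wv defu] := iota_WspP Wu; rewrite {u Wu}defu iota_coord.
pose v1 := v - (v 0 r / v0 0 r) *: v0.
have Wv1 : v1 \in Wsp A' U.
  by rewrite (WspU1 A' _ Ur) memvB ?memvZ //= !mxE divfK ?subrr.
have def_v : iota v = iota v1 + (v 0 r / v0 0 r) *: iota v0.
  by rewrite -linearZ -linearD subrK.
by rewrite def_v linearDr linearZr /= dot_phiU1 // add0r mulrC mulrA mulrAC.
Qed.

Definition cmp_map S : 'Hom(tens V' 'rV[K]_n, tens V 'rV[K]_n.+1) :=
  tmap (extmap a) (extmap (phi (tilde A' S))).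

Lemma extmap_a_Hproj U x :
  extmap a (Hproj A' U x) = Hproj A (fset U) (extmap a x).
Proof.
rewrite -!comp_lfunE -!extmap_comp; congr (fun_of_lfun (extmap _) x).
by apply/lfunP=> y; rewrite !comp_lfunE a_oproj.
Qed.

Lemma cmp_edge S r : r \notin S -> {in vertex (Tcube A') S, forall t,
  cmp_map (r |: S) (edge (Tcube A') S r t) =
  edge (Tcube A) (facet_set l c S) (lift l r) (cmp_map S t)}.
Proof.
move=> Sr t St.
rewrite -[edge (Tcube A') _ _]/(delta A' S r) -[edge (Tcube A) _ _]/(delta _ _ _).
rewrite -!comp_lfunE; move: t St; apply: eq_in_vertex => i j x y Hx Wy.
rewrite !comp_lfunE /cmp_map /delta tilde_facet pos_lift tmap_tensor.
case: ifPn => pr.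
  have tr := tilde_pos pr Sr; rewrite (tildeU_pos S pr).
  set U := tilde A' S in Hx Wy tr *; rewrite Vsp_facet // -facet_setU1.
  case: ifPn => Vr; rewrite !tmap_tensor extmap_a_Hproj; congr tensor.
    rewrite !id_lfunE; apply: eq_in_extmap Wy => w Ww.
    exact: phiU1_id.
  rewrite /wedge_nuv extmap_lwedge phi_nuv; apply: lwedge_extmap_mod Wy => w Ww.
  by apply: phiU1_mod => //; apply: negbNE.
have tr := tilde_neg pr Sr; rewrite (tildeU_neg S pr) -facet_setD1.
set U := tilde A' S :\ r; have Ur : r \notin U by rewrite !inE eqxx.
have defU : tilde A' S = r |: U by rewrite setD1K.
rewrite Vsp_facet // defU in Hx Wy *.
have proj_phi : extmap (phi U) (Wproj A' U y) =
    Wproj A (fset U) (extmap (phi (r |: U)) y).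
  rewrite -!comp_lfunE -!extmap_comp; apply: eq_in_extmap Wy => w Ww.
  by rewrite !comp_lfunE (phi_oproj Ww).
case: ifPn => Vr; rewrite !tmap_tensor proj_phi ?id_lfunE //; congr tensor.
by rewrite /wedge_nu extmap_lwedge a_oproj_nu.
Qed.

Theorem cmp_facet_iso : @facet_iso K n (Tcube A) l c (Tcube A') cmp_map.
Proof.
move=> S; split=> [||k|]; last exact: cmp_edge.
- by rewrite tmap_ker0 ?extmap_ker0.
- by rewrite /= tilde_facet dim_Hsp_facet dim_Wsp_facet.
rewrite /= tilde_facet limg_sum; apply: eq_bigr => i _.
by rewrite limg_tmap !limg_extmap a_Hsp limg_phi.
Qed.

End Comparison.

(** * Deletion *)

Section DeletionContraction.
Variables (K : fieldType) (V : vectType K) (n : nat) (A : arrangement V n.+1).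
Variable l : 'I_n.+1.
Hypothesis regA : regular A.
Implicit Types (U S : {set 'I_n}) (w : 'rV[K]_n).

Local Notation D := (deletion A l).
Local Notation C := (contraction A l).

Lemma tilde_facet_set b S :
  tilde A (facet_set l b S) = facet_set l (b == (l \in pos A)) (tilde D S).
Proof.
apply: eq_facet_set => [|j]; last by rewrite !inE lift_facet_set.
by rewrite !inE self_facet_set; case: b; case: (l \in pos A).
Qed.

Lemma lincomb_lift (v : 'rV[K]_n.+1) : lincomb A v =
  v 0 l *: nu A l + lincomb D (\row_j v 0 (lift l j)).
Proof.
rewrite !lincombE (bigD1_ord l) //=; congr (_ + _).
by apply: eq_bigr => j _; rewrite mxE.
Qed.

Lemma dot_lift (u v : 'rV[K]_n.+1) : dot u v = u 0 l * v 0 l +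
  dot (\row_j u 0 (lift l j)) (\row_j v 0 (lift l j)).
Proof.
rewrite /dot (bigD1_ord l) //=; congr (_ + _).
by apply: eq_bigr => j _; rewrite !mxE.
Qed.

Local Notation ins := (linfun (@insert0_fun K n l)).

Lemma insert0_lift w j : ins w 0 (lift l j) = w 0 j.
Proof. by rewrite lfunE !mxE liftK. Qed.

Lemma insert0_self w : ins w 0 l = 0.
Proof. by rewrite lfunE !mxE unlift_none. Qed.

Lemma row_lift (f : 'Hom('rV[K]_n, 'rV[K]_n.+1)) w :
  (forall u j, f u 0 (lift l j) = u 0 j) -> \row_j f w 0 (lift l j) = w.
Proof. by move=> f_lift; apply/rowP=> j; rewrite mxE. Qed.

Lemma lift_ker0 (f : 'Hom('rV[K]_n, 'rV[K]_n.+1)) :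
  (forall u j, f u 0 (lift l j) = u 0 j) -> lker f == 0%VS.
Proof.
move=> f_lift; apply/lker0P=> u v eq_uv.
by rewrite -(row_lift u f_lift) eq_uv row_lift.
Qed.

(** Shared by extension by zero and by completion of relations: in both cases
    the l-th coefficient of a relation is determined by the others, which makes
    f onto. *)
Lemma limg_lift_Wsp (f : 'Hom('rV[K]_n, 'rV[K]_n.+1)) (V' : vectType K)
    (A' : arrangement V' n) b U :
  (forall u j, f u 0 (lift l j) = u 0 j) ->
  (forall u, (lincomb A (f u) == 0) = (lincomb A' u == 0)) ->
  (b = false -> forall u, f u 0 l = 0) ->
  (forall v, v \in Wsp A (facet_set l b U) ->
     v 0 l = f (\row_j v 0 (lift l j)) 0 l) ->
  (f @: Wsp A' U)%VS = Wsp A (facet_set l b U).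
Proof.
move=> f_lift f_lin f_self f_det; apply/vspaceP=> v; apply/idP/idP.
  case/memv_imgP=> u /WspP[u0 out0] ->; apply/WspP; split.
    by apply/eqP; rewrite f_lin u0.
  move=> i; rewrite mem_facet_set; case: unliftP => [j ->|-> bF].
    by rewrite f_lift; apply: out0.
  by apply: f_self; apply: negbTE.
move=> Wv; set u := \row_j v 0 (lift l j); have [v0 out0] := WspP _ _ _ Wv.
have defv : v = f u.
  apply/rowP=> i; case: (unliftP l i) => [j ->|->]; last exact: f_det.
  by rewrite f_lift mxE.
rewrite defv memv_img //; apply/WspP; split=> [|j Uj].
  by apply/eqP; rewrite -f_lin -defv v0.
by rewrite mxE out0 // lift_facet_set.
Qed.

Lemma limg_insert0_Wsp U : (ins @: Wsp D U)%VS = Wsp A (facet_set l false U).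
Proof.
apply: limg_lift_Wsp => [u j|u|_ u|v /WspP[_ out0]].
- exact: insert0_lift.
- rewrite lincomb_lift insert0_self scale0r add0r row_lift //.
  exact: insert0_lift.
- exact: insert0_self.
by rewrite insert0_self out0 // self_facet_set.
Qed.

Lemma dot_insert0 u v : dot (ins u) (ins v) = dot u v.
Proof.
by rewrite dot_lift insert0_self mul0r add0r !row_lift //; apply: insert0_lift.
Qed.

Lemma Hsp_deletion U : Hsp D U = Hsp A (facet_set l false U).
Proof.
apply/vspaceP=> x; apply/HspP/HspP => Hx i Ui; last first.
  by apply: Hx; rewrite lift_facet_set.
by move: Ui; rewrite mem_facet_set; case: unliftP => [j ->|->//] /Hx.
Qed.

Lemma regular_deletion : regular D.
Proof.
move=> U; split; first by rewrite Hsp_deletion; apply: regH.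
apply/eqP; rewrite -subv0; apply/subvP=> w; rewrite memv_cap => /andP[Ww Ow].
have Wiw : ins w \in Wsp A (facet_set l false U).
  by rewrite -limg_insert0_Wsp memv_img.
have iw0 : ins w = 0.
  apply: (form_inj (regW regA _) Wiw); rewrite ?mem0v // => v.
  rewrite -limg_insert0_Wsp => /memv_imgP[u Wu ->] /=.
  by rewrite dot_insert0 linear0l; apply: form_orthov Ow Wu.
by rewrite memv0 -(row_lift w insert0_lift) iw0; apply/eqP/rowP=> j; rewrite !mxE.
Qed.

Lemma del_facet_iso :
  @facet_iso K n (Tcube A) l (l \notin pos A) (Tcube D) (fun _ => del_ident V l).
Proof.
have -> : (fun _ => del_ident V l) = cmp_map D \1%VF (fun _ => ins).
  by rewrite /cmp_map extmap_id.
have ins_ker0 : lker ins == 0%VS by apply: lift_ker0; apply: insert0_lift.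
apply: (@cmp_facet_iso _ _ _ _ A D l false (l \notin pos A) _ _ _ _ _ ins) => //.
- exact: regular_deletion.
- by move=> r; rewrite inE.
- by move=> S; rewrite tilde_facet_set; case: (l \in pos A).
- by apply/lker0P=> x y; rewrite !id_lfunE.
- by move=> U; rewrite lim1g Hsp_deletion.
- by move=> x y; rewrite !id_lfunE.
- by move=> x r; rewrite id_lfunE.
- exact: limg_insert0_Wsp.
- exact: insert0_lift.
- by move=> U w Ww; rewrite -limg_insert0_Wsp memv_img.
by move=> U w v _ _; apply: dot_insert0.
Qed.

(** * Contraction *)

Definition shear_fun (u v : 'rV[K]_n.+1) : 'rV[K]_n.+1 := v - v 0 l *: u.

Fact shear_linear u : linear (shear_fun u).
Proof.
move=> a v w; rewrite /shear_fun !mxE scalerDl -scalerA scalerBr opprD.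
by rewrite addrACA.
Qed.

HB.instance Definition _ u := GRing.isLinear.Build K 'rV[K]_n.+1 'rV[K]_n.+1 _
  (shear_fun u) (shear_linear u).

Definition shear u : 'End('rV[K]_n.+1) := linfun (shear_fun u).

Lemma shearE (u v : 'rV[K]_n.+1) : shear u v = v - v 0 l *: u.
Proof. by rewrite lfunE. Qed.

Lemma shear_id (u v : 'rV[K]_n.+1) : v 0 l = 0 -> shear u v = v.
Proof. by rewrite shearE => ->; rewrite scale0r subr0. Qed.

Lemma shear_self (u : 'rV[K]_n.+1) : shear u u = (1 - u 0 l) *: u.
Proof. by rewrite shearE scalerBl scale1r. Qed.

Lemma shear_ker0 (u : 'rV[K]_n.+1) : 1 - u 0 l != 0 -> lker (shear u) == 0%VS.
Proof.
move=> ul; rewrite -subv0; apply/subvP=> v.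
rewrite memv_ker memv0 shearE subr_eq0 => /eqP defv.
have : v 0 l * (1 - u 0 l) == 0 by rewrite mulrBr mulr1 {1}defv mxE subrr.
by rewrite mulf_eq0 (negPf ul) orbF {2}defv => /eqP->; rewrite scale0r.
Qed.

(** The vector of W_(U u l) that represents the l-th coordinate. *)
Definition omega U := oproj (@dot K n.+1) (Wsp A (facet_set l true U)) (nuv A l).

Lemma dot_omega U (v : 'rV[K]_n.+1) :
  v \in Wsp A (facet_set l true U) -> dot (omega U) v = v 0 l.
Proof. exact: dot_nuv. Qed.

Section NonzeroVector.
Hypotheses (nul_neq0 : nu A l != 0) (regC : regular C).
Local Notation P := (perp A l).
Local Notation cr := (linfun (complete_rel_fun A l)).

Lemma perpE x : (x \in P) = (form A x (nu A l) == 0).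
Proof. exact: mem_orthov1. Qed.

Lemma nondegenerate_perp : nondegenerate_on (form A) P.
Proof. by have := regH regA [set l]; rewrite /Hsp big_set1. Qed.

Lemma form_nul_neq0 : form A (nu A l) (nu A l) != 0.
Proof.
apply: contraNneq nul_neq0 => nu0; rewrite -memv0 -nondegenerate_perp memv_cap.
rewrite perpE nu0 eqxx; apply: mem_orthov => x.
by rewrite perpE sformC => /eqP.
Qed.

Lemma oproj_perp v : oproj (form A) P v =
  v - (form A v (nu A l) / form A (nu A l) (nu A l)) *: nu A l.
Proof.
apply: (oproj_uniq nondegenerate_perp) => [|x].
  by rewrite perpE linearBl linearZl_LR /= divfK ?subrr // form_nul_neq0.
rewrite perpE sformC => /eqP nux; rewrite linearBl linearZl_LR /= nux mulr0.
by rewrite subr0.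
Qed.

Lemma lincomb_contraction w :
  vsval (lincomb C w) = oproj (form A) P (lincomb D w).
Proof.
rewrite !lincombE !linear_sum; apply: eq_bigr => j _.
by rewrite !linearZ /= vsprojK ?oproj_mem.
Qed.

Lemma complete_rel_lift w j : cr w 0 (lift l j) = w 0 j.
Proof. by rewrite lfunE !mxE liftK. Qed.

Lemma complete_rel_self w : cr w 0 l =
  - (form A (lincomb D w) (nu A l) / form A (nu A l) (nu A l)).
Proof. by rewrite lfunE !mxE unlift_none. Qed.

Lemma lincomb_complete_rel w : lincomb A (cr w) = vsval (lincomb C w).
Proof.
rewrite lincomb_contraction oproj_perp lincomb_lift complete_rel_self.
by rewrite row_lift; [rewrite scaleNr addrC | apply: complete_rel_lift].
Qed.

Lemma limg_complete_rel_Wsp U :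
  (cr @: Wsp C U)%VS = Wsp A (facet_set l true U).
Proof.
apply: limg_lift_Wsp => [u j|u|//|v /WspP[v0 _]].
- exact: complete_rel_lift.
- by rewrite lincomb_complete_rel -(inj_eq val_inj).
move/eqP: v0; rewrite lincomb_lift addrC addr_eq0 => /eqP relv.
rewrite complete_rel_self relv -scaleNr linearZl_LR /= mulfK ?opprK //.
exact: form_nul_neq0.
Qed.

Lemma form_contraction (x : subvs_of P) j :
  form A (vsval x) (nu A (lift l j)) = form C x (nu C j).
Proof.
rewrite -[RHS]/(form A (vsval x) (vsval (vsproj P _))) vsprojK ?oproj_mem //.
by rewrite sformC [RHS]sformC (oproj_form nondegenerate_perp) // subvsP.
Qed.

Lemma limg_vsval_Hsp U :
  (linfun vsval @: Hsp C U)%VS = Hsp A (facet_set l true U).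
Proof.
apply/vspaceP=> x; apply/idP/idP => [/memv_imgP[y /HspP Hy ->] | /HspP Hx].
  apply/HspP=> i; rewrite mem_facet_set lfunE /=; case: unliftP => [j ->|-> _].
    by rewrite form_contraction => /Hy.
  by apply/eqP; rewrite -perpE subvsP.
have Px : x \in P by rewrite perpE Hx // self_facet_set.
apply/memv_imgP; exists (vsproj P x); last by rewrite lfunE /= vsprojK.
by apply/HspP=> j Uj; rewrite -form_contraction vsprojK // Hx // lift_facet_set.
Qed.

(** If the l-th coordinate of omega were 1, then the vector of the contraction
    that corresponds to omega would be orthogonal to all relations. *)
Lemma one_sub_omega_neq0 U : 1 - omega U 0 l != 0.
Proof.
rewrite subr_eq0; apply/eqP=> omega1.
have Womega : omega U \in Wsp A (facet_set l true U) by apply: oproj_mem.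
have := Womega; rewrite -limg_complete_rel_Wsp => /memv_imgP[w Ww def_omega].
suff w0 : w = 0.
  move/eqP: omega1; rewrite def_omega w0 linear0 mxE.
  by rewrite oner_eq0.
apply: (form_inj (regW regC U) Ww); rewrite ?mem0v // => v Wv /=.
have Wcv : cr v \in Wsp A (facet_set l true U).
  by rewrite -limg_complete_rel_Wsp memv_img.
have := dot_omega Wcv; rewrite dot_lift -omega1 mul1r def_omega.
rewrite !row_lift; try exact: complete_rel_lift.
by move/eqP; rewrite addrC -subr_eq0 addrK linear0l => /eqP.
Qed.

Definition con_phi U : 'Hom('rV[K]_n, 'rV[K]_n.+1) := (shear (omega U) \o cr)%VF.

Lemma con_phi_dot U u v : v \in Wsp C U -> dot (con_phi U u) (cr v) = dot u v.
Proof.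
move=> Wv; rewrite comp_lfunE shearE linearBl linearZl_LR /= dot_omega; last first.
  by rewrite -limg_complete_rel_Wsp memv_img.
rewrite dot_lift !row_lift; try exact: complete_rel_lift.
by rewrite addrAC subrr add0r.
Qed.

Lemma shear_Wsp U v : v \in Wsp A (facet_set l true U) ->
  shear (omega U) v \in Wsp A (facet_set l true U).
Proof. by move=> Wv; rewrite shearE memvB ?memvZ ?oproj_mem. Qed.

Lemma con_phi_ker0 U : lker (con_phi U) == 0%VS.
Proof.
have /lker0P shear_inj := shear_ker0 (one_sub_omega_neq0 U).
have /lker0P cr_inj := lift_ker0 complete_rel_lift.
by apply/lker0P=> u v; rewrite !comp_lfunE => /shear_inj/cr_inj.
Qed.

Definition con_map : {set 'I_n} -> 'Hom(amb (Tcube C), amb (Tcube A)) :=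
  cmp_map C (linfun vsval) con_phi.

Lemma con_facet_iso : @facet_iso K n (Tcube A) l (l \in pos A) (Tcube C) con_map.
Proof.
have cr_ker0 : lker cr == 0%VS by apply: lift_ker0 complete_rel_lift.
apply: (@cmp_facet_iso _ _ _ _ A C l true (l \in pos A) _ _ _ _ _ cr) => //.
- by move=> r; rewrite inE.
- by move=> S; rewrite tilde_facet_set eqxx.
- by apply/lker0P=> x y; rewrite !lfunE; apply: val_inj.
- exact: limg_vsval_Hsp.
- by move=> x y; rewrite !lfunE.
- by move=> x r; rewrite lfunE; apply: form_contraction.
- exact: limg_complete_rel_Wsp.
- exact: complete_rel_lift.
- exact: con_phi_ker0.
- move=> U w Ww; rewrite comp_lfunE shear_Wsp // -limg_complete_rel_Wsp.
  exact: memv_img.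
by move=> U w v _; apply: con_phi_dot.
Qed.

Lemma con_mapE S :
  con_map S = (tmap \1 (extmap (shear (omega (tilde D S)))) \o con_ident A l)%VF.
Proof. by rewrite tmap_comp comp_lfun1l -extmap_comp. Qed.

Lemma con_ident_ker0 : lker (con_ident A l) == 0%VS.
Proof.
apply: tmap_ker0; apply: extmap_ker0; last exact: lift_ker0 complete_rel_lift.
by apply/lker0P=> x y; rewrite !lfunE; apply: val_inj.
Qed.

Lemma limg_con_ident S : (con_ident A l @: vertex (Tcube C) S)%VS =
  vertex (Tcube A) (facet_set l (l \in pos A) S).
Proof.
rewrite /vertex; have [_ -> _ _] := con_facet_iso S.
rewrite limg_sum; apply: eq_bigr => k _; rewrite limg_sum; apply: eq_bigr => i _.
rewrite tilde_facet_set eqxx limg_tmap !limg_extmap.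
by rewrite limg_vsval_Hsp limg_complete_rel_Wsp.
Qed.

(** On the image of the l-th edge map, the shear that corrects con_ident is a
    scalar: it fixes W_U and multiplies omega by 1 - omega_l. *)
Lemma shear_edge_pos S t : l \in pos A ->
  t \in vertex (Tcube A) (facet_set l false S) ->
  tmap \1 (extmap (shear (omega (tilde D S))))
    (edge (Tcube A) (facet_set l false S) l t) =
  (1 - omega (tilde D S) 0 l) *: edge (Tcube A) (facet_set l false S) l t.
Proof.
move=> pl; set u := omega _; rewrite -[edge _ _ _]/(delta A _ _).
rewrite -comp_lfunE -scale_lfunE; move: t; apply: eq_in_vertex => i j x y _.
rewrite tilde_facet_set pl comp_lfunE scale_lfunE /delta pl tilde_facet_set pl.
rewrite -[false == true]/false -!facet_set_true => Wy.
set U := tilde D S in u Wy *.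
have lU : l \notin facet_set l false U by rewrite self_facet_set.
have shear_y : extmap (shear u) y = y.
  rewrite -[RHS]id_lfunE -extmap_id; apply: eq_in_extmap Wy => w /WspP[_ out0].
  by rewrite id_lfunE shear_id // out0.
case: ifPn => Vl; rewrite !tmap_tensor id_lfunE.
  have ul : u 0 l = 0.
    have : u \in Wsp A (facet_set l true U) by apply: oproj_mem.
    by rewrite facet_set_true (WspU1_id lU Vl) => /WspP[_ ->].
  by rewrite id_lfunE shear_y ul subr0 scale1r.
rewrite extmap_lwedge shear_y -/(omega U) shear_self linearZ scale_lfunE.
by rewrite linearZ.
Qed.

(** Orthogonal projection to W_U kills omega, hence does not see the shear. *)
Lemma shear_edge_neg S t : l \notin pos A ->
  t \in vertex (Tcube A) (facet_set l false S) ->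
  edge (Tcube A) (facet_set l false S) l
    (tmap \1 (extmap (shear (omega (tilde D S)))) t) =
  edge (Tcube A) (facet_set l false S) l t.
Proof.
move=> pl; set u := omega _; rewrite -[edge _ _ _]/(delta A _ _).
rewrite -comp_lfunE; move: t; apply: eq_in_vertex => i j x y _.
rewrite tilde_facet_set (negPf pl) comp_lfunE /delta (negPf pl) tilde_facet_set.
rewrite (negPf pl) -[false == false]/true facet_set_trueD.
set U := tilde D S in u *; move=> Wy.
have lU : l \notin facet_set l false U by rewrite self_facet_set.
have proj_shear : Wproj A (facet_set l false U) (extmap (shear u) y) =
    Wproj A (facet_set l false U) y.
  rewrite -comp_lfunE -extmap_comp; apply: eq_in_extmap Wy => w Ww.
  rewrite comp_lfunE; apply/esym/(oproj_uniq (regW regA _)); first exact: oproj_mem.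
  move=> v Wv; rewrite (oproj_form (regW regA _)) // shearE linearBl linearZl_LR /=.
  have Wlv : v \in Wsp A (facet_set l true U).
    by rewrite facet_set_true (subvP (sub_WspU1 A l _)).
  by rewrite dot_omega //; have /WspP[_ ->] := Wv; rewrite ?mulr0 ?subr0.
by case: ifPn => Vl; rewrite !tmap_tensor proj_shear id_lfunE.
Qed.

End NonzeroVector.

(** The comparison of the contraction with the facet where l lies in tilde S,
    covering both cases of its definition.  The comparison maps F differ from
    the identification, but agree with it on what the l-th edge map produces
    (up to a scalar at each vertex) or sees. *)
Lemma con_comparison : regular C -> exists F lambda,
  [/\ @facet_iso K n (Tcube A) l (l \in pos A) (icube (con A l)) F,
      lker (ident (con A l)) == 0%VS,
      forall S, (ident (con A l) @: vertex (icube (con A l)) S)%VS =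
        vertex (Tcube A) (facet_set l (l \in pos A) S),
      forall S, lambda S != 0 &
      if l \in pos A then
        forall S t u, t \in vertex (Tcube A) (facet_set l false S) ->
          ident (con A l) u = edge (Tcube A) (facet_set l false S) l t ->
          F S u = lambda S *: edge (Tcube A) (facet_set l false S) l t
      else
        forall S u, u \in vertex (icube (con A l)) S ->
          edge (Tcube A) (facet_set l false S) l (F S u) =
          edge (Tcube A) (facet_set l false S) l (ident (con A l) u)].
Proof.
move=> regC; rewrite /con; case: eqP => [nu0 | /eqP nu_neq0].
  have id_iso := facet_iso_id (Tcube A) l (l \in pos A).
  exists (fun _ => facet_ident (Tcube A) l (l \in pos A)), (fun _ => 1); split=> //.
  - by case: (id_iso set0).
  - by move=> S; rewrite -(limg_facet_vertex id_iso).
  - by move=> S; rewrite oner_neq0.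
  by case: ifP => // _ S t u _ /= ->; rewrite scale1r.
exists con_map, (fun S => 1 - omega (tilde D S) 0 l); split=> /=.
- exact: con_facet_iso.
- exact: con_ident_ker0.
- exact: limg_con_ident.
- by move=> S; apply: one_sub_omega_neq0.
case: ifPn => pl S => [t u Vt def_u | u Vu]; rewrite con_mapE comp_lfunE.
  by rewrite def_u shear_edge_pos.
rewrite shear_edge_neg // -[false](negPf pl) -limg_con_ident //.
exact: memv_img.
Qed.

(** * The connecting maps as edge maps *)

Fact gamma_plus_linear : linear (gamma_plus_cochain A l).
Proof. by move=> a u v; apply/ffunP=> S; rewrite !ffunE !linearP. Qed.

HB.instance Definition _ := GRing.isLinear.Build K _ _ _
  (gamma_plus_cochain A l) gamma_plus_linear.

Fact gamma_minus_linear : linear (gamma_minus_cochain A l).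
Proof. by move=> a u v; apply/ffunP=> S; rewrite !ffunE !linearP. Qed.

HB.instance Definition _ := GRing.isLinear.Build K _ _ _
  (gamma_minus_cochain A l) gamma_minus_linear.

Lemma gamma_plusE S : l \in pos A ->
  gamma_plus A l S = edge (Tcube A) (facet_set l false S) l.
Proof. by move=> pl; rewrite /= /delta pl. Qed.

Lemma gamma_minusE S : l \notin pos A ->
  gamma_minus A l S = edge (Tcube A) (facet_set l false S) l.
Proof.
by move=> /negPf pl; rewrite /= /delta pl /gamma_minus if_neg.
Qed.

Lemma cross_edge_vertex S t : t \in vertex (Tcube A) (facet_set l false S) ->
  edge (Tcube A) (facet_set l false S) l t \in
    vertex (Tcube A) (facet_set l true S).
Proof.
by apply: (edge_vertex (Tcube_qgrading regA)); rewrite self_facet_set.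
Qed.

End DeletionContraction.

Theorem theorem3p8 (K : fieldType) (char0 : [pchar K] =i pred0)
    (V : vectType K) (n : nat) (A : arrangement V n.+1) (l : 'I_n.+1)
    (regA : regular A) (regC : regular (contraction A l))
    (eps : scalars K n.+1) (eps_ok : anticommuting (Tcube A) eps) :
  exists (epsD epsC : scalars K n),
  [/\ anticommuting (Tcube (deletion A l)) epsD,
      anticommuting (icube (con A l)) epsC,
      l \in pos A ->
        long_exact (icube (con A l)) epsC (Tcube A) eps
          (Tcube (deletion A l)) epsD (gamma_plus_cochain A l) &
      l \notin pos A ->
        long_exact (Tcube (deletion A l)) epsD (Tcube A) eps
          (icube (con A l)) epsC (gamma_minus_cochain A l)].
Proof.
have [F [lambda [F_iso id_ker0 id_vertex lambda_neq0 F_edge]]] :=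
  con_comparison regA regC.
have D_iso := del_facet_iso l regA; have grA := Tcube_qgrading regA.
case: (boolP (l \in pos A)) F_iso D_iso id_vertex F_edge
  => pl F_iso D_iso id_vertex F_edge.
  have c_edge z S : z \in Defs.total (Tcube (deletion A l)) ->
      gamma_plus_cochain A l z S \in vertex (icube (con A l)) S /\
      F S (gamma_plus_cochain A l z S) =
        lambda S *: edge (Tcube A) (facet_set l false S) l (del_ident V l (z S)).
    move=> Tz; have Vz := totalP _ Tz S.
    have Vdz : del_ident V l (z S) \in vertex (Tcube A) (facet_set l false S).
      by rewrite (facet_vertex D_iso).
    have := cross_edge_vertex regA Vdz.
    rewrite -id_vertex => /memv_imgP[u Vu def_u].
    rewrite ffunE gamma_plusE // def_u lker0_lfunK //; split=> //.
    by rewrite -def_u; apply: F_edge.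
  exists (facet_eps l false eps (fun _ => 1)),
         (facet_eps l true eps (cross_scaling l eps lambda)); split=> // [||_].
  - exact: (quot_facet_anticommuting eps_ok grA D_iso).
  - exact: (sub_facet_anticommuting eps_ok grA F_iso lambda_neq0).
  exact: (facet_long_exact eps_ok grA F_iso D_iso lambda_neq0 c_edge).
have one_neq0 (S : {set 'I_n}) : (fun _ => 1 : K) S != 0 by apply: oner_neq0.
have c_edge z S : z \in Defs.total (icube (con A l)) ->
    gamma_minus_cochain A l z S \in vertex (Tcube (deletion A l)) S /\
    del_ident V l (gamma_minus_cochain A l z S) =
      1 *: edge (Tcube A) (facet_set l false S) l (F S (z S)).
  move=> Tz; have Vz := totalP _ Tz S; rewrite scale1r F_edge //.
  have := memv_img (ident (con A l)) Vz; rewrite id_vertex => Viz.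
  have [u Vu def_u] := facet_vertexP D_iso (cross_edge_vertex regA Viz).
  have [D_ker0 _ _ _] := D_iso S.
  by rewrite ffunE gamma_minusE // def_u lker0_lfunK.
exists (facet_eps l true eps (cross_scaling l eps (fun _ => 1))),
       (facet_eps l false eps (fun _ => 1)); split=> // [||_].
- exact: (sub_facet_anticommuting eps_ok grA D_iso one_neq0).
- exact: (quot_facet_anticommuting eps_ok grA F_iso).
exact: (facet_long_exact eps_ok grA D_iso F_iso one_neq0 c_edge).
Qed.
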